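(* For any $n\ge1$ and any integer $d\ge 0$, the number of Dyck paths of semilength $n$, deficit $d$, and area $a$ is the same for every integer $$a\in\left[d,\ \binom n2-2d\right].$$
   Context: Dyck paths of semilength $n$ are identified with Dyck sequences of length $n$: sequences of nonnegative integers $(d_1,\dots,d_n)$ with $d_1=0$ and $d_{i+1}\le d_i+1$ for all $i$. For such a sequence $D$: $\operatorname{area}(D)=\sum_i d_i$, $\operatorname{dinv}(D)=\#\{(i,j):1\le i<j\le n,\ d_i-d_j\in\{0,1\}\}$, and the deficit is $\operatorname{defc}(D)=\binom n2-\operatorname{area}(D)-\operatorname{dinv}(D)$. *)

(* Defs.v *)
From mathcomp Require Import all_boot all_order all_algebra.

Set Implicit Arguments.
Unset Strict Implicit.
Unset Printing Implicit Defensive.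

Definition is_dyck (s : seq nat) : bool :=
  (head 0 s == 0) && sorted (fun x y => y <= x.+1) s.

Definition area (s : seq nat) : nat := \sum_(x <- s) x.

Definition dinv (s : seq nat) : nat :=
  #|[set p : 'I_(size s) * 'I_(size s) | (p.1 < p.2) &&
      ((nth 0 s p.1 == nth 0 s p.2) || (nth 0 s p.1 == (nth 0 s p.2).+1))]|.

(* Integer-valued, so that the subtraction is not truncated. *)
Definition defc (s : seq nat) : int :=
  ('C(size s, 2)%:Z - (area s)%:Z - (dinv s)%:Z)%R.

(* Entries are taken in 'I_n to obtain a finite type; by dyck_nth_leq the
   entries of a Dyck sequence of length n are all smaller than n. *)
Definition dyck_paths (n : nat) (d a : int) : {set n.-tuple 'I_n} :=
  [set t : n.-tuple 'I_n | let s := map val t in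
    [&& is_dyck s, defc s == d & (area s)%:Z%R == a]].

Lemma dyck_nth_leq (s : seq nat) (i : nat) :
  is_dyck s -> i < size s -> nth 0 s i <= i.
Proof.
case/andP=> s0 ss; elim: i => [|i IHi] lt_is; first by rewrite nth0 (eqP s0).
case: s s0 ss IHi lt_is => // x s _ /= /(pathP 0) xs IHi lt_is.
by apply: leq_trans (xs i lt_is) _; rewrite ltnS IHi 1?ltnW.
Qed.

(* Main.v *)
Require Import Defs.
From mathcomp Require Import all_boot all_order all_algebra.
From mathcomp Require Import zify ring.

Set Implicit Arguments.
Unset Strict Implicit.
Unset Printing Implicit Defensive.

Import Order.TTheory GRing.Theory Num.Theory.

(** Give a Dyck sequence s the monomial t^(area s) q^(dinv s), let C_n(q, t) be
the sum over the sequences of length n, and write C for the binomial of n and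
2.  A monomial t^a q^b has deficit C - a - b, so the numbers of paths of areas
a - 1 and a in one deficit differ by a coefficient of (q - t) C_n, and the
theorem says that each monomial t^a q^b of (q - t) C_n satisfies
2 a + b <= C + 1 or a + 2 b <= C + 1.  In other words (q - t) C_n is a sum of
a polynomial of small (2, 1)-degree and one of small (1, 2)-degree, where the
(al, be)-degree gives weight al to t and be to q.

The two parts are found by interpolation.  C_n is the value at v = 0 of a
q,t-Schröder polynomial P_n(v), called Phi v n 1 below: this is dyck_seqs_gf,
which builds a sequence level by level, a level being the set of entries of a
given value.  Take v = - q^i and v = - t q^j as nodes.  In the Lagrange formula
for v = 0 the denominators are products of differences of two nodes.  One of
the two nodes has at least the degree of the other for both gradings, except in
the pairs q^(j+1), t q^j, whose denominators are removed by the factor q - t.  Hence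
both degrees extend to the fractions that occur, and it is enough to bound one
of them for each summand: a sum of such fractions that is a polynomial splits
as wanted (fsplit_poly).

The values at the nodes are small for the following reasons.  At v = - q^i the
q-binomial theorem kills all contributions with more than i entries in some
level (Theta_eq0); what remains has few entries in each level, hence a large
area and a small (1, 2)-degree (wdeg_Theta_R, Rbound_le).  At v = - t q^j, the identity
  P_n(t u) = (1 + t u) sum_r q^(r choose 2) t^(n - r) Phi u (n - r) r
(Phi1_shift) leads back to values at - q^j, with a bottom level added whose
number r of entries is arbitrary.  If r is small compared with the number of entries
above, the (1, 2)-degree is still small; if r is large, then many pairs
contribute neither to area nor to dinv, and the (2, 1)-degree is small
(piece_bound).  The degrees match exactly those of the Lagrange coefficients
(fdeg_q_term, fsplit_t_term). *)

(** * Dyck sequences by insertion of zeros *)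

Local Notation step := (fun x y : nat => y <= x.+1).
Local Notation zstep := (fun x y : nat => (x == 0) ==> (y <= 1)).
Local Notation pos := (fun x : nat => 0 < x).

(** The words with r zeros whose nonzero letters spell w, such that a zero is
followed only by a zero or a one.  They are listed by first letter, so that
Pascal's rule for their inversions is visible; k stands for their length. *)
Fixpoint insert_zeros k (w : seq nat) r : seq (seq nat) :=
  if k is k'.+1 then
    (if r is r'.+1 then
       if head 1 w <= 1 then map (cons 0) (insert_zeros k' w r') else [::]
     else [::]) ++
    (if w is x :: w' then map (cons x) (insert_zeros k' w' r) else [::])
  else [:: [::]].

Lemma zstep_head l : path zstep 0 l -> head 1 (filter pos l) <= 1.
Proof. by elim: l => //= -[|y] l IHl //= /andP[]. Qed.

(** The definition compares an inserted zero with the next nonzero letter only;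
zstep_head carries this over a run of zeros. *)
Lemma mem_insert_zeros k w r l : all pos w -> size w + r = k ->
  (l \in insert_zeros k w r) =
  [&& sorted zstep l, filter pos l == w & count_mem 0 l == r].
Proof.
elim: k w r l => [|k IHk] w r l wpos wk.
  have [-> ->] : w = [::] /\ r = 0 by split; [apply: size0nil|]; lia.
  by case: l => [|[|x] l] //=; rewrite !andbF.
case: l => [|[|y] l].
- rewrite /= (_ : [::] \in _ = false); last first.
    by case: r {wk} => [|r]; case: w {wpos} => [|x w] /=; rewrite ?mem_cat;
      try case: ifP => _; rewrite ?orbF //=; apply/negbTE/negP;
      rewrite ?mem_cat => H; move: H; (try case/orP) => /mapP[].
  by case: w wpos wk => [|x w] //=; case: r.
- rewrite [insert_zeros k.+1 w r]/= mem_cat [X in _ || X](_ : _ = false) ?orbF; last first.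
    case: w wpos {wk} => [|x w] //= /andP[x_gt0 _].
    by apply/negP => /mapP[l' _ [x0]]; rewrite -x0 in x_gt0.
  case: r wk => [|r] wk; first by rewrite /= add1n !andbF.
  rewrite /= add1n eqSS.
  case: ifP => [le1|gt1]; last first.
    rewrite in_nil; apply/esym/negP => /and3P[/zstep_head le1 /eqP eqw _].
    by rewrite eqw gt1 in le1.
  rewrite mem_map; last by move=> ? ? [].
  rewrite IHk //; last by lia.
  case Efil: (filter pos l == w); last by rewrite !andbF.
  case: (count_mem 0 l == r); last by rewrite !andbF.
  rewrite !andbT; case: l Efil => [|[|y] l] //= /eqP eqw.
  by rewrite -eqw /= in le1; rewrite le1.
rewrite [insert_zeros k.+1 w r]/= mem_cat [X in X || _](_ : _ = false) ?orFb; last first.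
  case: r {wk} => // r; case: ifP => // _.
  by apply/negP => /mapP[l' _ []].
case: w wpos wk => [|x w] /=; first by rewrite !andbF.
move=> /andP[x_gt0 wpos] wk; rewrite add0n eqseq_cons.
have -> : path zstep y.+1 l = sorted zstep l by case: l.
have [<-|nexy] := eqVneq y.+1 x; last first.
  rewrite andbF; apply/negP => /mapP[l' _ [xy _]].
  by rewrite xy eqxx in nexy.
rewrite mem_map; last by move=> ? ? [].
by rewrite IHk //; lia.
Qed.

Lemma insert_zeros_uniq k w r : all pos w -> uniq (insert_zeros k w r).
Proof.
elim: k w r => [|k IHk] w r wpos //=; rewrite cat_uniq; apply/and3P; split.
- case: r => // r; case: ifP => // _; rewrite map_inj_uniq ?IHk //.
  by move=> ? ? [].
- case: w wpos => [|x w] //= /andP[x_gt0 _]; apply/hasPn => l.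
  case/mapP => l' _ ->; case: r => // r; case: ifP => // _.
  by apply/negP => /mapP[? _ [x0]]; rewrite x0 in x_gt0.
- case: w wpos => [|x w] //= /andP[_ wpos]; rewrite map_inj_uniq ?IHk //.
  by move=> ? ? [].
Qed.

(** Zeros can be deleted because a letter that follows a zero is at most 1, and
so at most c + 1 for the nonzero letter c that precedes the zeros. *)
Lemma step_filter p c l : (p == 0) || (p == c) ->
  path step p l = path zstep p l && path step c (filter pos l).
Proof.
elim: l p c => [|y l IHl] p c //= pc.
case: y => [|y] /=.
  rewrite implybT /=; apply: IHl.
  by [].
rewrite (IHl y.+1 y.+1) ?eqxx ?orbT //.
case: (path zstep _ _); rewrite ?andbF // !andTb andbT.
case: (path step y.+1 _); rewrite ?andbF ?andbT //.
by case: p pc => [|p] /= pc; [lia | rewrite (eqP pc)].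
Qed.

Lemma dyck_step0 s : path step 0 (map succn s) = is_dyck s.
Proof.
by case: s => //= y s; rewrite /is_dyck /= path_map ltnS leqn0.
Qed.

(** Without its zeros and lowered by one, a Dyck sequence is again a Dyck
sequence, and the zeros may stand anywhere before a zero or a one. *)
Lemma dyck_cons0 l :
  is_dyck (0 :: l) =
  path zstep 0 l && is_dyck (map predn (filter pos l)).
Proof.
transitivity (path step 0 l); first by [].
rewrite (@step_filter 0 0) // -dyck_step0; congr (_ && path _ _ _).
rewrite -map_comp map_id_in // => x.
by rewrite mem_filter => /andP[x_gt0 _] /=; rewrite prednK.
Qed.

(** The first argument is fuel; r is the number of zeros, of which the leading
one is not inserted. *)
Fixpoint dyck_seqs_rec k n : seq (seq nat) :=
  if k is k'.+1 then
    if n is 0 then [:: [::]] else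
    flatten [seq flatten [seq map (cons 0) (insert_zeros n.-1 (map succn w) r.-1)
      | w <- dyck_seqs_rec k' (n - r)] | r <- index_iota 1 n.+1]
  else [:: [::]].

Definition dyck_seqs n := dyck_seqs_rec n n.

Lemma dyck_seqs_recS k n : dyck_seqs_rec k.+1 n.+1 =
    flatten [seq flatten [seq map (cons 0) (insert_zeros n (map succn w) r.-1)
      | w <- dyck_seqs_rec k (n.+1 - r)] | r <- index_iota 1 n.+2].
Proof. by []. Qed.

Lemma dyck_seqs_recE k l n : n <= k -> n <= l -> dyck_seqs_rec k n = dyck_seqs_rec l n.
Proof.
elim: k l n => [|k IHk] [|l] [|n] // lek lel.
rewrite !dyck_seqs_recS; apply: (congr1 flatten); apply/eq_in_map => r.
rewrite mem_index_iota => /andP[r_gt0 _].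
by rewrite (IHk l) //; lia.
Qed.

Lemma dyck_seqsE n : 0 < n -> dyck_seqs n =
    flatten [seq flatten [seq map (cons 0) (insert_zeros n.-1 (map succn w) r.-1)
      | w <- dyck_seqs (n - r)] | r <- index_iota 1 n.+1].
Proof.
case: n => // n _; rewrite /dyck_seqs dyck_seqs_recS.
apply: (congr1 flatten); apply/eq_in_map => r.
rewrite mem_index_iota => /andP[r_gt0 _].
by rewrite (@dyck_seqs_recE n (n.+1 - r)) //; lia.
Qed.

Lemma mem_dyck_seqs n l : (l \in dyck_seqs n) = is_dyck l && (size l == n).
Proof.
elim/ltn_ind: n l => -[_|n IHn] l.
  by rewrite inE size_eq0; case: eqP => [->|]; rewrite ?andbF.
rewrite dyck_seqsE //; apply/flattenP/idP => [[L /mapP[r]]|].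
  rewrite mem_index_iota => /andP[r_gt0 ltr] -> /flattenP[L' /mapP[w]].
  rewrite IHn; last lia.
  move=> /andP[dw /eqP sw] -> /mapP[l'].
  rewrite mem_insert_zeros; last 2 first.
  - by apply/allP => x /mapP[y _ ->].
  - by rewrite size_map sw /=; lia.
  case/and3P=> zl /eqP fl /eqP cl ->.
  rewrite dyck_cons0 fl -map_comp map_id_in ?dw ?andbT; last by move=> x.
  rewrite [size (0 :: l')]/= eqSS; have -> : size l' = n.
    rewrite -(count_predC pos l') -size_filter fl size_map sw.
    rewrite (eq_count (a2 := pred1 0)) ?cl; first lia.
    by move=> x /=; case: x.
  rewrite eqxx andbT.
  case: l' zl fl {cl} => [|[|y] l'] //= -> ; rewrite ?andbT //=.
  rewrite -dyck_step0 in dw.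
  by case: w dw {sw} => // x w /= /andP[lex _] [-> _].
case: l => [|[|x] l]; rewrite ?andbF //.
rewrite dyck_cons0 [size _]/= eqSS => /andP[/andP[zl dl] /eqP sl].
have cl : count_mem 0 l <= n by rewrite -sl count_size.
exists (flatten [seq map (cons 0) (insert_zeros n (map succn w) (count_mem 0 l))
      | w <- dyck_seqs (n - count_mem 0 l)]).
  apply/mapP; exists (count_mem 0 l).+1; rewrite ?mem_index_iota ?subSS //=.
apply/flattenP; exists (map (cons 0) (insert_zeros n (filter pos l) (count_mem 0 l))).
  apply/mapP; exists (map predn (filter pos l)).
    rewrite IHn; last lia.
    rewrite dl size_map size_filter -sl -(count_predC pos l).
    rewrite (eq_count (a2 := pred1 0) (a1 := predC _)) ?addnK ?eqxx //.
    by move=> x /=; case: x.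
  congr (map _ (insert_zeros _ _ _)); rewrite -map_comp map_id_in // => x.
  by rewrite mem_filter => /andP[x_gt0 _] /=; rewrite prednK.
apply/map_f; rewrite mem_insert_zeros ?eqxx ?andbT.
- by case: l zl {dl sl cl} => //= y l /andP[].
- by apply/allP => x; rewrite mem_filter => /andP[].
rewrite size_filter -sl -[RHS](count_predC pos l); congr (_ + _).
by apply: eq_count => x /=; case: x.
Qed.

Local Notation dpair := (fun x y : nat => (x == y) || (x == y.+1)).

Lemma dinvE s : dinv s =
  \sum_(i < size s) \sum_(j < size s) ((i < j) && dpair (nth 0 s i) (nth 0 s j)).
Proof.
rewrite /dinv -sum1_card pair_big /= big_mkcond; apply: eq_bigr => p _.
by rewrite inE; case: ifP.
Qed.

Lemma dinv_cons x s : dinv (x :: s) = count (dpair x) s + dinv s.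
Proof.
rewrite !dinvE /= big_ord_recl big_ord_recl /= add0n; congr (_ + _).
  rewrite -sum1_count [RHS]big_mkcond (big_nth 0) big_mkord.
  by apply: eq_bigr => i _ /=; case: ifP.
by apply: eq_bigr => i _; rewrite big_ord_recl /= add0n.
Qed.

Lemma area_cons x s : area (x :: s) = x + area s.
Proof. by rewrite /area big_cons. Qed.

Lemma uniq_flatten_map (T1 T2 : eqType) (f : T1 -> seq T2) (g : T2 -> T1) s :
  uniq s -> {in s, forall x, uniq (f x)} ->
  {in s, forall x, {in f x, forall y, g y = x}} -> uniq (flatten (map f s)).
Proof.
elim: s => //= x s IHs /andP[xs us] uf gf; rewrite cat_uniq.
rewrite uf ?mem_head // IHs //= ?andbT; last 2 first.
- by move=> y ys; apply: uf; rewrite inE ys orbT.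
- by move=> y ys; apply: gf; rewrite inE ys orbT.
apply/hasPn => z /flattenP[l /mapP[y ys ->] zy]; apply/negP => zx.
have yx : y = x by rewrite -(gf y _ z) ?(gf x _ z) ?mem_head // inE ys orbT.
by rewrite -yx ys in xs.
Qed.

Lemma insert_zeros_perm k w r l : size w + r = k ->
  l \in insert_zeros k w r -> perm_eq l (nseq r 0 ++ w).
Proof.
elim: k w r l => [|k IHk] w r l wk.
  have [-> ->] : w = [::] /\ r = 0 by split; [apply: size0nil|]; lia.
  by rewrite inE => /eqP->.
rewrite /= mem_cat => /orP[].
  case: r wk => // r wk; case: ifP => // _ /mapP[l' l'in ->].
  by rewrite /= perm_cons IHk //; lia.
case: w wk => // x w wk /mapP[l' l'in ->].
rewrite perm_sym -cat1s perm_catCA /= perm_cons perm_sym IHk //.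
by rewrite /= in wk; lia.
Qed.

Lemma dyck_seqs_uniq n : uniq (dyck_seqs n).
Proof.
elim/ltn_ind: n => -[|n IHn] //; rewrite dyck_seqsE //.
have Spos (w : seq nat) : all (fun x => 0 < x) (map succn w).
  by apply/allP => x /mapP[y _ ->].
apply: (@uniq_flatten_map _ _ _ (count_mem 0)); first exact: iota_uniq.
  move=> r; rewrite mem_index_iota => /andP[r_gt0 ltr].
  apply: (@uniq_flatten_map _ _ _ (fun l => map predn (filter (fun x => 0 < x) l))).
  - by apply: IHn; lia.
  - by move=> w _; rewrite map_inj_uniq ?insert_zeros_uniq //; move=> ? ? [].
  move=> w; rewrite mem_dyck_seqs => /andP[_ /eqP sw] l /mapP[l' l'in ->] /=.
  move: l'in; rewrite mem_insert_zeros //; last by rewrite size_map sw; lia.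
  by case/and3P=> _ /eqP-> _; rewrite -map_comp map_id_in.
move=> r; rewrite mem_index_iota => /andP[r_gt0 ltr] l.
case/flattenP=> L /mapP[w]; rewrite mem_dyck_seqs => /andP[_ /eqP sw] -> /mapP[l'].
rewrite mem_insert_zeros //; last by rewrite size_map sw /=; lia.
by case/and3P=> _ _ /eqP cl -> /=; rewrite cl; lia.
Qed.

Lemma dinv_mapS w : dinv (map succn w) = dinv w.
Proof.
elim: w => [|x w IHw] //=; rewrite !dinv_cons IHw count_map.
by congr (_ + _); apply: eq_count => y /=; rewrite !eqSS.
Qed.

Lemma area_mapS w : area (map succn w) = size w + area w.
Proof.
elim: w => [|x w IHw] /=; first by rewrite /area !big_nil.
by rewrite !area_cons IHw; lia.
Qed.

Local Open Scope ring_scope.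

(** * Gaussian binomial coefficients and sums over triangles *)

Section GaussianBinomials.
Variables (R : comNzRingType) (q : R).
Implicit Types n k : nat.

(** Gaussian binomials over any commutative ring.  Quotients of q-factorials make
no sense there, which is why Pascal's rules carry the proofs. *)
Fixpoint gbin n k : R :=
  match n, k with
  | _, 0 => 1
  | 0, _.+1 => 0
  | n'.+1, k'.+1 => gbin n' k' + q ^+ k * gbin n' k
  end.

Arguments gbin : simpl never.

Lemma gbin0 n : gbin n 0 = 1. Proof. by case: n. Qed.

Lemma gbinS n k : gbin n.+1 k.+1 = gbin n k + q ^+ k.+1 * gbin n k.+1.
Proof. by []. Qed.

Lemma gbin_small n k : (n < k)%N -> gbin n k = 0.
Proof.
elim: n k => [|n IHn] [|k] // ltnk.
by rewrite gbinS !IHn ?mulr0 ?addr0 //; lia.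
Qed.

Lemma gbinn n : gbin n n = 1.
Proof. by elim: n => // n IHn; rewrite gbinS IHn gbin_small // mulr0 addr0. Qed.

Lemma gbinSr n k : (k <= n)%N ->
  gbin n.+1 k.+1 = gbin n k.+1 + q ^+ (n - k) * gbin n k.
Proof.
elim: n k => [|n IHn] [|k] // lekn; first by rewrite /gbin /= expr0; ring.
  by rewrite gbinS {1}(IHn 0%N) // (gbinS n 0) !gbin0 !subn0 !exprS expr0; ring.
have [lt_kn | ge_kn] := ltnP k n; last first.
  have -> : k = n by lia.
  by rewrite !gbinn subnn gbin_small // mulr1 add0r.
rewrite (gbinS n.+1) [in LHS](IHn k) 1?ltnW // [in LHS](IHn k.+1) // !(gbinS n) subSS.
rewrite (_ : (n - k = (n - k.+1).+1)%N); last lia.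
rewrite !exprS; ring.
Qed.

Lemma gbin_sym i j : gbin (i + j) i = gbin (i + j) j.
Proof.
elim: i j => [|i IHi] j; first by rewrite gbin0 add0n gbinn.
elim: j => [|j IHj]; first by rewrite gbin0 addn0 gbinn.
rewrite [in LHS]addSn gbinS [in RHS]addSn gbinSr; last lia.
by rewrite IHi -addSnnS IHj; congr (_ + _ ^+ _ * _); lia.
Qed.

Lemma gbin_sub n k : (k <= n)%N -> gbin n (n - k) = gbin n k.
Proof. by move=> /subnK eqn; rewrite -{1 3}eqn gbin_sym. Qed.

(** Both sides are the q-multinomial coefficient with parts a, b and c: Pascal's
rule on each factor gives them the same recursion of three terms. *)
Lemma gbin_trinomial a b c :
  gbin (a + b + c) (a + b) * gbin (a + b) a =
  gbin (a + b + c) a * gbin (b + c) b.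
Proof.
move: {2}(a + b + c)%N (leqnn (a + b + c)) => N.
elim: N a b c => [|N IHN] a b c le_abc.
  by have [-> [-> ->]] : a = 0%N /\ b = 0%N /\ c = 0%N by lia.
case: a le_abc => [|a] le_abc; first by rewrite !add0n !gbin0 mulr1 mul1r.
case: b le_abc => [|b] le_abc; first by rewrite !addn0 gbinn gbin0 mulr1.
case: c le_abc => [|c] le_abc; first by rewrite !addn0 !gbinn mul1r mulr1.
have := IHN a b.+1 c.+1 ltac:(lia).
have := IHN a.+1 b c.+1 ltac:(lia).
have := IHN a.+1 b.+1 c ltac:(lia).
rewrite (_ : (a.+1 + b.+1 + c.+1 = (a + b + c).+3)%N); last lia.
rewrite (_ : (a.+1 + b.+1 + c = (a + b + c).+2)%N); last lia.
rewrite (_ : (a.+1 + b + c.+1 = (a + b + c).+2)%N); last lia.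
rewrite (_ : (a + b.+1 + c.+1 = (a + b + c).+2)%N); last lia.
rewrite (_ : (a.+1 + b.+1 = (a + b).+2)%N); last lia.
rewrite (_ : (a.+1 + b = (a + b).+1)%N); last lia.
rewrite (_ : (a + b.+1 = (a + b).+1)%N); last lia.
rewrite (_ : (b.+1 + c.+1 = (b + c).+2)%N); last lia.
rewrite (_ : (b.+1 + c = (b + c).+1)%N); last lia.
rewrite (_ : (b + c.+1 = (b + c).+1)%N); last lia.
move=> H3 H2 H1.
rewrite (gbinS (a + b + c).+2 (a + b).+1) mulrDl -mulrA H3.
rewrite (gbinS (a + b).+1 a) mulrDr mulrCA H1 H2.
rewrite [in RHS](gbinS (a + b + c).+2 a) [in RHS]mulrDl -[X in _ = _ + X]mulrA.
rewrite [in X in _ = _ + _ * X](gbinS (b + c).+1 b).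
rewrite (_ : (a + b).+2 = (a.+1 + b.+1)%N) ?exprD; last lia.
ring.
Qed.

(** The truncated difference in the exponent does no harm, as gbin N (K - j)
vanishes for K - j > N. *)
Lemma gbin_vandermonde M N K :
  gbin (M + N) K =
  \sum_(0 <= j < K.+1) q ^+ (j * (N - (K - j))) * gbin M j * gbin N (K - j).
Proof.
elim: M K => [|M IHM] K.
  rewrite big_nat_recl // big1 => [|j _]; last by rewrite /= mulr0 mul0r.
  by rewrite mul0n gbin0 subn0 !mul1r addr0.
case: K => [|K].
  by rewrite big_nat1 !gbin0 !mulr1 mul0n.
have [leKMN | ltMNK] := leqP K (M + N); last first.
  rewrite gbin_small; last lia.
  rewrite big_nat_cond big1 // => j; rewrite andbT => /andP[_ ltjK].
  have [ltj|lej] := ltnP M.+1 j; first by rewrite gbin_small // mulr0 mul0r.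
  by rewrite (@gbin_small N) ?mulr0 //; lia.
rewrite addSn gbinSr // IHM (IHM K).
rewrite [RHS]big_nat_recl // [X in X + _]big_nat_recl // -addrA; congr (_ + _).
  by rewrite !gbin0.
rewrite mulr_sumr -big_split /=; apply: eq_big_nat => j /andP[_ ltjK].
rewrite subSS.
have [ltMj|lejM] := ltnP M j.
  by rewrite !(@gbin_small M) ?(@gbin_small M.+1) ?mulr0 ?mul0r ?mulr0 ?addr0 //; lia.
rewrite gbinSr // mulrDr mulrDl; congr (_ + _).
have [ltN|leN] := ltnP N (K - j); first by rewrite (@gbin_small N) // !mulr0.
rewrite !mulrA -exprD; congr (_ * _ * _).
rewrite [X in _ = X]mulrC mulrC.
by rewrite -exprD; congr (_ ^+ _); nia.
Qed.

(** The homogeneous form is needed for x a power of q, in psiE. *)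
Lemma gbin_prod n (v x : R) :
  \prod_(0 <= l < n) (v + x * q ^+ l) =
  \sum_(0 <= e < n.+1) q ^+ 'C(e, 2) * gbin n e * x ^+ e * v ^+ (n - e).
Proof.
elim: n => [|n IHn]; first by rewrite big_geq // big_nat1 /= !mulr1.
rewrite big_nat_recr //= IHn mulrDr !mulr_suml [RHS]big_nat_recl //=.
rewrite (_ : \sum_(0 <= i < n.+1)
      q ^+ 'C(i, 2) * gbin n i * x ^+ i * v ^+ (n - i) * v =
  v ^+ n.+1 + \sum_(0 <= i < n.+1)
    q ^+ 'C(i.+1, 2) * gbin n i.+1 * x ^+ i.+1 * v ^+ (n - i)); last first.
  rewrite big_nat_recl //= [in RHS]big_nat_recr //= (@gbin_small n n.+1) //.
  rewrite mulr0 !mul0r addr0 gbin0 !expr0 !mul1r subn0 -exprSr; congr (_ + _).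
  apply: eq_big_nat => i /andP[_ lti].
  by rewrite -mulrA -exprSr; congr (_ * _ ^+ _); lia.
rewrite gbin0 !expr0 !mul1r subn0 -addrA; congr (_ + _).
rewrite -big_split /=; apply: eq_big_nat => i /andP[_ lei].
rewrite subSS gbinSr // mulrDr !mulrDl; congr (_ + _).
rewrite [q ^+ _ * (_ * _)]mulrA -exprD.
rewrite (_ : ('C(i.+1, 2) + (n - i) = 'C(i, 2) + n)%N).
  by rewrite exprD exprS; ring.
by rewrite binS bin1; lia.
Qed.

Lemma gbin_prod1 n (v : R) :
  \prod_(0 <= l < n) (v + q ^+ l) =
  \sum_(0 <= e < n.+1) q ^+ 'C(e, 2) * gbin n e * v ^+ (n - e).
Proof.
under eq_bigr do rewrite -[q ^+ _]mul1r.
by rewrite gbin_prod; apply: eq_bigr => e _; rewrite expr1n mulr1.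
Qed.

End GaussianBinomials.

Arguments gbin {R} q n k : simpl never.

Lemma bin2D m n : 'C(m + n, 2) = ('C(m, 2) + 'C(n, 2) + m * n)%N.
Proof.
elim: m => [|m IHm]; first by rewrite bin0n mul0n addn0.
by rewrite addSn !binS !bin1 IHm; lia.
Qed.

Lemma bin2_double n : ('C(n, 2) * 2 = n * n.-1)%N.
Proof.
elim: n => [|n IHn] //; rewrite binS bin1 mulnDl IHn.
by case: n {IHn} => [|n] //=; nia.
Qed.

Section Triangles.
Variable V : nmodType.

Lemma sum_triangle N (F : nat -> nat -> V) :
  \sum_(0 <= m < N.+1) \sum_(0 <= r < m.+1) F (m - r)%N r =
  \sum_(0 <= r < N.+1) \sum_(0 <= h < (N - r).+1) F h r.
Proof.
elim: N => [|N IHN]; first by rewrite !big_nat1.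
rewrite big_nat_recr //= IHN [in RHS]big_nat_recr //= subnn big_nat1.
rewrite [X in _ + X]big_nat_recr //= subnn addrA -big_split /=; congr (_ + _).
apply: eq_big_nat => r /andP[_ ltr].
by rewrite [in RHS]subSn // [in RHS]big_nat_recr //= subSn.
Qed.

Lemma sum_triangleC N (F : nat -> nat -> V) :
  \sum_(0 <= r < N.+1) \sum_(0 <= h < (N - r).+1) F h r =
  \sum_(0 <= h < N.+1) \sum_(0 <= r < (N - h).+1) F h r.
Proof.
rewrite -sum_triangle -(sum_triangle N (fun r h => F h r)).
apply: eq_big_nat => m _; rewrite big_nat_rev /=.
by apply: eq_big_nat => r /andP[_ ltr]; congr (F _ _); lia.
Qed.

Lemma sum_shift k n (G : nat -> V) :
  (forall e, (e < k)%N -> G e = 0) -> (forall e, (n < e)%N -> G e = 0) ->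
  \sum_(0 <= e < n.+1) G e = \sum_(0 <= f < n.+1) G (k + f)%N.
Proof.
move=> G_lt G_gt; transitivity (\sum_(0 <= e < n.+1 + k) G e).
  rewrite [RHS](@big_cat_nat _ _ _ n.+1) ?leq_addr //=.
  rewrite [X in _ = _ + X]big_nat_cond [X in _ = _ + X]big1 ?addr0 // => e.
  by rewrite andbT => /andP[lte _]; apply: G_gt.
rewrite (@big_cat_nat _ _ _ k) ?leq_addl //=.
rewrite big_nat_cond big1 ?add0r => [|e]; last first.
  by rewrite andbT => /andP[_]; apply: G_lt.
rewrite -{1}[k]add0n big_addn addnK.
by apply: eq_bigr => f _; rewrite addnC.
Qed.

End Triangles.

(** * Schröder polynomials *)

Section Schroder.
Variables (R : comNzRingType) (q t : R).
Implicit Types v u : R.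
Notation gbin := (gbin q).

(** Phi v N r is the sum over the ways to put N entries above a level with r
undecorated entries.  The next level has m entries, which can be interleaved
with those r entries, the first of which comes first; among the m entries, e
are undecorated and each of the others has a factor v.  Only the e undecorated
entries are seen by the level above.  With v = 0 one gets Dyck sequences, and
Phi v n 1 is a q,t-Schröder polynomial.  The first argument of Phi_rec is
fuel. *)
Fixpoint Phi_rec k v N r : R :=
  if k is k'.+1 then
    if N is 0 then 1 else
    \sum_(1 <= m < N.+1) gbin (r + m).-1 m * (t ^+ (N - m) *
      \sum_(0 <= e < m.+1)
        q ^+ 'C(e, 2) * gbin m e * v ^+ (m - e) * Phi_rec k' v (N - m)%N e)
  else 1.

Definition Phi v N r := Phi_rec N v N r.

(** The part of Phi with m entries in the first level, up to the factor for
interleaving them with the level below. *)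
Definition Theta v N m :=
  t ^+ (N - m) * \sum_(0 <= e < m.+1)
    q ^+ 'C(e, 2) * gbin m e * v ^+ (m - e) * Phi v (N - m) e.

Lemma Phi_recE k l v N r : (N <= k)%N -> (N <= l)%N ->
  Phi_rec k v N r = Phi_rec l v N r.
Proof.
elim: k l N r => [|k IHk] [|l] [|N] r //= lek lel.
apply: eq_big_nat => m /andP[m_gt0 _].
congr (_ * (_ * _)); apply: eq_bigr => e _.
by congr (_ * _); apply: IHk; lia.
Qed.

Lemma Phi0 v r : Phi v 0 r = 1. Proof. by []. Qed.

Lemma PhiE v N r : (0 < N)%N ->
  Phi v N r = \sum_(1 <= m < N.+1) gbin (r + m).-1 m * Theta v N m.
Proof.
case: N => // N _; apply: eq_big_nat => m /andP[m_gt0 _].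
congr (_ * (_ * _)); apply: eq_bigr => e _.
by congr (_ * _); apply: Phi_recE; lia.
Qed.

Lemma Phi_r0 v N : (0 < N)%N -> Phi v N 0 = 0.
Proof.
move=> N_gt0; rewrite PhiE // big_nat_cond big1 // => m.
rewrite andbT => /andP[m_gt0 _].
by rewrite gbin_small ?mul0r //; lia.
Qed.

(** Allowing an empty first level makes the recursion hold for N = 0 as well,
which is what the manipulations of sums in Phi_shift need. *)
Lemma Phi_sum v N r :
  Phi v N r = \sum_(0 <= m < N.+1) gbin (r + m).-1 m * Theta v N m.
Proof.
rewrite big_nat_recl // /Theta subn0 big_nat1 !gbin0 !mul1r.
case: N => [|N]; first by rewrite big_geq // !mulr1 addr0.
by rewrite Phi_r0 // !mulr0 add0r PhiE // big_add1.
Qed.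

(** The coefficient of x^r in the product over l < s of
(1 + T q^l x) / (1 - q^l x). *)
Definition xi T s r := \sum_(0 <= k < r.+1)
  T ^+ k * q ^+ 'C(k, 2) * gbin s k * gbin (r - k + s).-1 (r - k).

Lemma xi0 T s : xi T s 0 = 1.
Proof. by rewrite /xi big_nat1 !gbin0 !mulr1. Qed.

Lemma xi1 T r : (0 < r)%N -> xi T 1 r = 1 + T.
Proof.
case: r => // r _; rewrite /xi big_nat_recl // big_nat_recl //= big1 => [|k _].
  by rewrite !gbin0 !gbinn !addn1 subn0 subSS subn0 /= !gbinn expr1; ring.
by rewrite gbin_small // mulr0 mul0r.
Qed.

(** Put e = k + f.  The power of T depends only on f, and the sum over k is a
q-Vandermonde convolution. *)
Lemma xi_sum_step T n r : (0 < n)%N ->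
  \sum_(0 <= e < n.+1) q ^+ 'C(e, 2) * gbin n e * T ^+ (n - e) * xi T e r =
  gbin (n + r).-1 r * \prod_(0 <= l < n) (T + q ^+ l).
Proof.
move=> n_gt0.
transitivity (\sum_(0 <= k < r.+1) \sum_(0 <= f < n.+1)
    q ^+ 'C(k + f, 2) * gbin n (k + f) * T ^+ (n - (k + f)) *
    (T ^+ k * q ^+ 'C(k, 2) * gbin (k + f) k * gbin (r - k + (k + f)).-1 (r - k))).
  under eq_bigr do rewrite mulr_sumr.
  rewrite exchange_big /=; apply: eq_bigr => k _.
  apply: (sum_shift (G := fun e => q ^+ 'C(e, 2) * gbin n e * T ^+ (n - e) *
    (T ^+ k * q ^+ 'C(k, 2) * gbin e k * gbin (r - k + e).-1 (r - k)))) => e lte.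
    by rewrite (@gbin_small _ _ e) // mulr0 mul0r mulr0.
  by rewrite (@gbin_small _ _ n) // mulr0 !mul0r.
rewrite exchange_big /=.
rewrite gbin_prod1 mulr_sumr; apply: eq_big_nat => f /andP[_ ltf].
rewrite [RHS]mulrC.
rewrite (_ : gbin (n + r).-1 r = gbin (n - f + (r + f).-1) r); last first.
  case: (posnP (r + f)) => [rf0|rf_gt0]; last by congr (gbin _ _); lia.
  by rewrite (_ : r = 0%N) ?gbin0 //; lia.
rewrite gbin_vandermonde mulr_sumr; apply: eq_big_nat => k /andP[_ ltk].
rewrite (_ : (r - k + (k + f) = r + f)%N); last lia.
have [lekf|ltkf] := leqP (k + f) n; last first.
  rewrite (@gbin_small _ _ n) //; rewrite (@gbin_small _ _ (n - f)); last lia.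
  by rewrite !(mulr0, mul0r).
rewrite (_ : T ^+ (n - f) = T ^+ (n - (k + f)) * T ^+ k); last first.
  by rewrite -exprD; congr (_ ^+ _); lia.
have tri : gbin n (k + f) * gbin (k + f) k = gbin n f * gbin (n - f) k.
  have := gbin_trinomial q f k (n - (k + f)).
  rewrite (_ : (f + k + (n - (k + f)) = n)%N); last lia.
  rewrite (_ : (k + (n - (k + f)) = n - f)%N); last lia.
  by rewrite gbin_sym addnC.
have ex : q ^+ 'C(k + f, 2) * q ^+ 'C(k, 2) =
  q ^+ 'C(f, 2) * q ^+ (k * ((r + f).-1 - (r - k))).
  rewrite -!exprD bin2D; congr (_ ^+ _); have := bin2_double k.
  by case: k {tri} ltk lekf => //= k; nia.
transitivity ((q ^+ 'C(k + f, 2) * q ^+ 'C(k, 2)) *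
  (gbin n (k + f) * gbin (k + f) k) * (T ^+ (n - (k + f)) * T ^+ k) *
  gbin (r + f).-1 (r - k)); first by ring.
by rewrite ex tri; ring.
Qed.

(** The same method as for xi_sum_step, with the roles of the two indices of xi
exchanged. *)
Lemma xi_sum_entry T n s : (0 < n)%N ->
  \sum_(0 <= e < n.+1) q ^+ 'C(e, 2) * T ^+ (n - e) * gbin n.-1 (n - e) * xi T s e =
  gbin (s + n).-1 n * \prod_(0 <= l < n) (T + q ^+ l).
Proof.
move=> n_gt0.
transitivity (\sum_(0 <= f < n.+1) \sum_(0 <= k < (n - f).+1)
    q ^+ 'C(f + k, 2) * T ^+ (n - (f + k)) * gbin n.-1 (n - (f + k)) *
    (T ^+ k * q ^+ 'C(k, 2) * gbin s k * gbin (f + s).-1 f)).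
  rewrite -sum_triangleC -sum_triangle; apply: eq_bigr => e _.
  rewrite mulr_sumr; apply: eq_big_nat => k /andP[_ ltk].
  by rewrite subnK //.
rewrite gbin_prod1 mulr_sumr; apply: eq_big_nat => f /andP[_ ltf].
have tri : gbin (s + n).-1 n * gbin n f = gbin (f + s).-1 f * gbin (s + n.-1) (n - f).
  case: s => [|s].
    rewrite add0n gbin_small ?mul0r; last lia.
    case: f ltf => [|f] ltf; last by rewrite gbin_small ?mul0r //; lia.
    by rewrite add0n subn0 [X in _ * X]gbin_small ?mulr0 //; lia.
  have := gbin_trinomial q (n - f) f s.
  rewrite (_ : (n - f + f + s = (s.+1 + n).-1)%N); last lia.
  rewrite (_ : (n - f + f = n)%N); last lia.
  have lefn : (f <= n)%N by [].
  rewrite (gbin_sub _ lefn) => ->; rewrite mulrC addnS /=.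
  by congr (_ * gbin _ _); lia.
transitivity (q ^+ 'C(f, 2) * T ^+ (n - f) *
  (gbin (s + n).-1 n * gbin n f)); last by ring.
rewrite tri gbin_vandermonde !mulr_sumr; apply: eq_big_nat => k /andP[_ ltk].
rewrite (_ : T ^+ (n - f) = T ^+ (n - (f + k)) * T ^+ k); last first.
  by rewrite -exprD; congr (_ ^+ _); lia.
rewrite (_ : (n - (f + k) = n - f - k)%N); last lia.
have ex : q ^+ 'C(f + k, 2) * q ^+ 'C(k, 2) =
  q ^+ 'C(f, 2) * q ^+ (k * (n.-1 - (n - f - k))).
  rewrite -!exprD bin2D; congr (_ ^+ _); have := bin2_double k.
  by case: k ltk => //= k ltk; nia.
transitivity ((q ^+ 'C(f + k, 2) * q ^+ 'C(k, 2)) * (T ^+ (n - f - k) * T ^+ k) *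
  gbin n.-1 (n - f - k) * gbin s k * gbin (f + s).-1 f); first by ring.
by rewrite ex; ring.
Qed.

(** A decorated entry of level c contributes t^c (t u) on the left.  Read as
t^(c + 1) u this is a decorated entry of level c + 1 on the right, and xi
accounts for the level that loses its decorated entries.  Unfolding the
recursion once on either side gives sums over triples (e, h, r), where e and r
are numbers of undecorated entries in consecutive levels and h is the number
of decorated entries between them; these sums agree because xi_sum_step and
xi_sum_entry give the same product, up to trinomial revision. *)
Theorem Phi_shift u N s :
  Phi (t * u) N s = \sum_(0 <= r < N.+1)
    q ^+ 'C(r, 2) * t ^+ (N - r) * xi (t * u) s r * Phi u (N - r) r.
Proof.
elim/ltn_ind: N s => -[_|N IHN] s.
  by rewrite big_nat1 xi0 !Phi0 !mulr1.
(* The common value of the two sides, as a sum over n = e + h and r. *)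
pose G n r := gbin (s + n).-1 n * gbin (n + r).-1 r *
  \prod_(0 <= l < n) (t * u + q ^+ l) * q ^+ 'C(r, 2) *
  t ^+ (N.+1 - n) * t ^+ (N.+1 - n - r) * Phi u (N.+1 - n - r) r.
transitivity (\sum_(1 <= n < N.+2) \sum_(0 <= r < (N.+1 - n).+1) G n r).
  rewrite PhiE //; apply: eq_big_nat => n /andP[n_gt0 ltn].
  transitivity (gbin (s + n).-1 n * (t ^+ (N.+1 - n) * \sum_(0 <= e < n.+1)
    q ^+ 'C(e, 2) * gbin n e * (t * u) ^+ (n - e) *
    \sum_(0 <= r < (N.+1 - n).+1)
      q ^+ 'C(r, 2) * t ^+ (N.+1 - n - r) * xi (t * u) e r * Phi u (N.+1 - n - r) r)).
    congr (_ * (_ * _)); apply: eq_bigr => e _; congr (_ * _); apply: IHN; lia.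
  under eq_bigr do rewrite mulr_sumr.
  rewrite exchange_big /= !mulr_sumr; apply: eq_bigr => r _.
  rewrite /G -(mulrA (gbin (s + n).-1 n)) -xi_sum_step //.
  rewrite !mulr_sumr !mulr_suml; apply: eq_bigr => e _.
  set P := Phi u _ _; set X := xi _ _ _; ring.
transitivity (\sum_(0 <= r < N.+2) \sum_(0 <= n < (N.+1 - r).+1)
  \sum_(0 <= e < n.+1) q ^+ 'C(e, 2) * (t * u) ^+ (n - e) * gbin n.-1 (n - e) *
    xi (t * u) s e * (gbin (n + r).-1 r * q ^+ 'C(r, 2) *
    t ^+ (N.+1 - n) * t ^+ (N.+1 - n - r) * Phi u (N.+1 - n - r) r)).
  rewrite sum_triangleC [RHS]big_nat_recl // [X in _ = X + _]big1 => [|r _].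
    rewrite add0r big_add1 /=; apply: eq_bigr => n _.
    apply: eq_bigr => r _; rewrite -mulr_suml xi_sum_entry // /G; ring.
  rewrite big_nat1 subn0 add0n; case: r => [|r]; first by rewrite Phi_r0 // !mulr0.
  by rewrite [gbin r.+1.-1 _]gbin_small // !(mul0r, mulr0).
transitivity (\sum_(0 <= r < N.+2) \sum_(0 <= e < (N.+1 - r).+1)
  \sum_(0 <= h < (N.+1 - r - e).+1)
   q ^+ 'C(e, 2) * (t * u) ^+ h * gbin (e + h).-1 h *
    xi (t * u) s e * (gbin (e + h + r).-1 r * q ^+ 'C(r, 2) *
    t ^+ (N.+1 - (e + h)) * t ^+ (N.+1 - (e + h) - r) * Phi u (N.+1 - (e + h) - r) r)).
  apply: eq_bigr => r _; rewrite -sum_triangle; apply: eq_bigr => n _.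
  apply: eq_big_nat => e /andP[_ lte].
  by rewrite subnKC.
rewrite sum_triangleC; apply: eq_big_nat => e /andP[_ lte].
rewrite Phi_sum mulr_sumr.
transitivity (\sum_(0 <= m < (N.+1 - e).+1) \sum_(0 <= r < m.+1)
   q ^+ 'C(e, 2) * t ^+ (N.+1 - e) * xi (t * u) s e *
    (gbin (e + (m - r + r)).-1 (m - r + r) * (t ^+ (N.+1 - e - (m - r + r)) * (
     q ^+ 'C(r, 2) * gbin (m - r + r) r * u ^+ (m - r) * Phi u (N.+1 - e - (m - r + r)) r)))); last first.
  apply: eq_bigr => m _; rewrite /Theta !mulr_sumr.
  by apply: eq_big_nat => r /andP[_ ltr]; rewrite subnK.
rewrite (sum_triangle (N.+1 - e) (fun h r =>
   q ^+ 'C(e, 2) * t ^+ (N.+1 - e) * xi (t * u) s e *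
    (gbin (e + (h + r)).-1 (h + r) * (t ^+ (N.+1 - e - (h + r)) * (
     q ^+ 'C(r, 2) * gbin (h + r) r * u ^+ h * Phi u (N.+1 - e - (h + r)) r))))).
apply: eq_big_nat => r /andP[_ ltr].
rewrite (_ : (N.+1 - r - e = N.+1 - e - r)%N); last lia.
apply: eq_big_nat => h /andP[_ lth].
have tri : gbin (e + (h + r)).-1 (h + r) * gbin (h + r) r =
    gbin (e + h + r).-1 r * gbin (e + h).-1 h.
  case: e lte ltr lth => [|e] lte ltr lth; last first.
    have := gbin_trinomial q r h e.
    rewrite (_ : (r + h + e = (e.+1 + (h + r)).-1)%N); last lia.
    rewrite (_ : (r + h = h + r)%N); last lia.
    rewrite (_ : (h + e = (e.+1 + h).-1)%N); last lia.
    by rewrite addnA.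
  rewrite !add0n; case: h lth => [|h] _; last first.
    rewrite (@gbin_small _ _ (h.+1 + r).-1); last lia.
    by rewrite (@gbin_small _ _ h) // mulr0 mul0r.
  by rewrite !add0n gbinn !gbin0 mulr1.
rewrite (_ : (N.+1 - e - (h + r) = N.+1 - (e + h) - r)%N); last lia.
rewrite exprMn (_ : t ^+ (N.+1 - e) = t ^+ (N.+1 - (e + h)) * t ^+ h); last first.
  by rewrite -exprD; congr (_ ^+ _); lia.
set P := Phi u _ _; set X := xi _ _ _.
transitivity (q ^+ 'C(e, 2) * (t ^+ h * u ^+ h) * X *
  (gbin (e + h + r).-1 r * gbin (e + h).-1 h) * (q ^+ 'C(r, 2) *
  t ^+ (N.+1 - (e + h)) * t ^+ (N.+1 - (e + h) - r) * P)); first by ring.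
by rewrite -tri; ring.
Qed.

(** This reduces the value at - t q^j to values at - q^j; the number r of entries
in the lowest level is not restricted. *)
Corollary Phi1_shift u n : (0 < n)%N ->
  Phi (t * u) n 1 = (1 + t * u) *
    \sum_(1 <= r < n.+1) q ^+ 'C(r, 2) * t ^+ (n - r) * Phi u (n - r) r.
Proof.
move=> n_gt0; rewrite Phi_shift big_nat_recl // Phi_r0 ?subn0 // mulr0 add0r.
rewrite big_add1 mulr_sumr; apply: eq_bigr => r _.
by rewrite xi1 //; set P := Phi _ _ _; ring.
Qed.

(** The contribution of a level of m entries below one of m' entries, summed over
the number of undecorated entries (psiE).  Since it is a combination of
products of v + q^l, its zeros and degrees at v = - q^i can be read off. *)
Definition psi v m m' := \sum_(0 <= j < m'.+1)
  gbin m'.-1 j * q ^+ 'C(m' - j, 2) * gbin m (m' - j) *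
  \prod_(0 <= l < m - (m' - j)) (v + q ^+ (m' + l)).

(** The q-Vandermonde convolution separates e from m', after which the sum over e
is an instance of the q-binomial theorem. *)
Lemma psiE v m m' : (0 < m')%N ->
  \sum_(0 <= e < m.+1)
    q ^+ 'C(e, 2) * gbin m e * v ^+ (m - e) * gbin (e + m').-1 m' = psi v m m'.
Proof.
move=> m'_gt0.
transitivity (\sum_(0 <= j < m'.+1) \sum_(0 <= e < m.+1)
    q ^+ 'C(e, 2) * gbin m e * v ^+ (m - e) *
    (q ^+ (j * (e - (m' - j))) * gbin m'.-1 j * gbin e (m' - j))).
  rewrite exchange_big /=; apply: eq_bigr => e _.
  rewrite -mulr_sumr -gbin_vandermonde.
  by rewrite (_ : (m'.-1 + e = (e + m').-1)%N) //; lia.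
apply: eq_big_nat => j /andP[_ ltj]; set k := (m' - j)%N.
rewrite (sum_shift (k := k)) => [|e lte|e lte]; last first.
- by rewrite (@gbin_small _ _ m) // mulr0 !mul0r.
- by rewrite (@gbin_small _ _ e) // !mulr0.
have [lekm|ltmk] := leqP k m; last first.
  rewrite (@gbin_small _ _ m k) // mulr0 mul0r.
  rewrite big1 // => f _; rewrite gbin_small ?mulr0 ?mul0r //; lia.
under [X in _ = _ * X]eq_bigr do rewrite exprD.
rewrite gbin_prod mulr_sumr.
rewrite [LHS](@big_cat_nat _ _ _ (m - k).+1) //=; last lia.
rewrite [X in _ + X]big_nat_cond [X in _ + X]big1 ?addr0 => [|f]; last first.
  rewrite andbT => /andP[ltf _]; rewrite gbin_small ?mulr0 ?mul0r //; lia.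
apply: eq_big_nat => f /andP[_ ltf].
have tri : gbin m (k + f) * gbin (k + f) k = gbin m k * gbin (m - k) f.
  have := gbin_trinomial q k f (m - k - f).
  rewrite (_ : (k + f + (m - k - f) = m)%N); last lia.
  by rewrite (_ : (f + (m - k - f) = m - k)%N); last lia.
have ex : q ^+ 'C(k + f, 2) * q ^+ (j * (k + f - k)) =
    q ^+ 'C(k, 2) * q ^+ 'C(f, 2) * (q ^+ m') ^+ f.
  by rewrite -exprM -!exprD bin2D; congr (_ ^+ _); rewrite /k; nia.
rewrite (_ : (m - (k + f) = m - k - f)%N); last lia.
transitivity (q ^+ 'C(k + f, 2) * q ^+ (j * (k + f - k)) *
  (gbin m (k + f) * gbin (k + f) k) * v ^+ (m - k - f) * gbin m'.-1 j); first by ring.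
by rewrite ex tri; ring.
Qed.

Lemma Theta_diag v m : Theta v m m = \prod_(0 <= l < m) (v + q ^+ l).
Proof.
rewrite /Theta subnn mul1r gbin_prod1; apply: eq_bigr => e _.
by rewrite Phi0 mulr1.
Qed.

Lemma Theta_rec v N m : (m < N)%N ->
  Theta v N m = t ^+ (N - m) *
    \sum_(1 <= m' < (N - m).+1) psi v m m' * Theta v (N - m) m'.
Proof.
move=> ltmN; rewrite {1}/Theta; congr (_ * _).
under eq_bigr => e _ do rewrite PhiE ?subn_gt0 // mulr_sumr.
rewrite exchange_big /=; apply: eq_big_nat => m' /andP[m'_gt0 _].
by rewrite -psiE // mulr_suml; apply: eq_bigr => e _; rewrite mulrA.
Qed.

End Schroder.

(** * The generating function of Dyck sequences *)

Section Weights.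
Variables (R : comNzRingType) (q t : R).

(** The pairs added to dinv consist of two zeros or of a one and a later zero.
So this counts words in zeros and ones by inversions: the two choices for the
first letter are the two terms of Pascal's rule. *)
Lemma insert_zeros_weight k w r : (size w + r = k)%N -> all (fun x => 0 < x)%N w ->
  \sum_(l <- insert_zeros k w r) q ^+ dinv l =
  q ^+ (dinv w + 'C(r, 2)) * gbin q (r + count_mem 1%N w) (count_mem 1%N w).
Proof.
elim: k w r => [|k IHk] w r wk wpos.
  have [-> ->] : w = [::] /\ r = 0%N by split; [apply: size0nil|]; lia.
  by rewrite big_seq1 gbin0 addn0 mulr1.
have second x w' : w = x :: w' -> \sum_(l <- insert_zeros k w' r) q ^+ dinv (x :: l) =
    q ^+ (dinv w + 'C(r, 2)) * q ^+ (r * (x == 1%N)) *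
      gbin q (r + count_mem 1%N w') (count_mem 1%N w').
  move=> Ew; rewrite Ew /= in wk wpos; case/andP: wpos => x_gt0 wpos.
  transitivity (\sum_(l <- insert_zeros k w' r)
      q ^+ (count (dpair x) w' + r * (x == 1%N)) * q ^+ dinv l).
    apply: eq_big_seq => l lin; rewrite dinv_cons exprD; congr (q ^+ _ * _).
    rewrite (permP (insert_zeros_perm _ lin)); last lia.
    rewrite count_cat count_nseq /= addnC mulnC.
    by case: (x) x_gt0.
  rewrite -mulr_sumr IHk //; last lia.
  by rewrite Ew dinv_cons mulrA -!exprD; congr (q ^+ _ * _); lia.
have first r' : r = r'.+1 -> (head 1%N w <= 1)%N ->
    \sum_(l <- insert_zeros k w r') q ^+ dinv (0%N :: l) =
    q ^+ (dinv w + 'C(r, 2)) * gbin q (r' + count_mem 1%N w) (count_mem 1%N w).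
  move=> Er _; rewrite Er /= in wk *.
  transitivity (\sum_(l <- insert_zeros k w r') q ^+ r' * q ^+ dinv l).
    apply: eq_big_seq => l lin; rewrite dinv_cons exprD; congr (q ^+ _ * _).
    rewrite (permP (insert_zeros_perm _ lin)); last lia.
    rewrite count_cat count_nseq /= mul1n.
    rewrite (@eq_in_count _ _ pred0) ?count_pred0 ?addn0 // => y.
    by move=> /(allP wpos); case: y.
  rewrite -mulr_sumr IHk //; last lia.
  by rewrite mulrA -exprD binS bin1; congr (q ^+ _ * _); lia.
rewrite /= big_cat /=.
case: w => [|x w] in wk wpos first second *.
  rewrite big_nil addr0; case: r wk first {second} => [|r] wk first; first by [].
  by rewrite /= big_map first // !gbin0.
rewrite big_map (second _ _ erefl) /=.
have x_gt0 : (0 < x)%N by case/andP: wpos.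
have [x1|nex1] := eqVneq x 1%N; last first.
  rewrite muln0 expr0 mulr1 add0n.
  have -> : (x <= 1)%N = false by lia.
  by case: (r) => [|?]; rewrite big_nil add0r.
subst x; rewrite /= add1n muln1; case: r wk first {second} => [|r] wk first.
  by rewrite big_nil add0r mulr1 !add0n !gbinn.
rewrite big_map (first r) //= add1n; clear; move: (count_mem _ w) => c.
rewrite (_ : (r.+1 + c.+1 = (r + c.+1).+1)%N); last lia.
rewrite gbinSr; last lia.
rewrite (_ : (r + c.+1 - c = r.+1)%N); last lia.
rewrite (_ : (r.+1 + c = r + c.+1)%N); last lia.
ring.
Qed.

Lemma Theta_v0 N m : Theta q t 0 N m =
  t ^+ (N - m) * (q ^+ 'C(m, 2) * Phi q t 0 (N - m) m).
Proof.
rewrite /Theta big_nat_recr //= big_nat_cond big1 ?add0r => [|e].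
  by rewrite subnn gbinn expr0 !mulr1.
rewrite andbT => /andP[_ lte]; rewrite expr0n.
by rewrite (_ : (m - e == 0)%N = false) ?mulr0 ?mul0r //; lia.
Qed.

(** The function f of the number of zeros makes the induction work: for the next
level it is the binomial that counts the interleavings. *)
Lemma dyck_seqs_weight n (f : nat -> R) : (0 < n)%N ->
  \sum_(l <- dyck_seqs n) t ^+ area l * q ^+ dinv l * f (count_mem 0%N l) =
  \sum_(1 <= r < n.+1) Theta q t 0 n r * f r.
Proof.
elim/ltn_ind: n f => n IHn f n_gt0.
rewrite dyck_seqsE // big_flatten /= big_map; apply: eq_big_seq => r.
rewrite mem_index_iota => /andP[r_gt0 ltr].
rewrite big_flatten /= big_map.
pose g s := gbin q (r.-1 + s) s.
transitivity (\sum_(w <- dyck_seqs (n - r))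
   t ^+ (n - r) * q ^+ 'C(r, 2) * f r * (t ^+ area w * q ^+ dinv w * g (count_mem 0%N w))).
  apply: eq_big_seq => w; rewrite mem_dyck_seqs => /andP[dw /eqP sw].
  have wpos : all (fun x => 0 < x)%N (map succn w) by apply/allP => x /mapP[y _ ->].
  have szw : (size (map succn w) + r.-1 = n.-1)%N by rewrite size_map sw; lia.
  rewrite big_map.
  transitivity (\sum_(l <- insert_zeros n.-1 (map succn w) r.-1)
     t ^+ (n - r + area w) * q ^+ r.-1 * f r * q ^+ dinv l).
    apply: eq_big_seq => l lin; have pl := insert_zeros_perm szw lin.
    have -> : area (0%N :: l) = (n - r + area w)%N.
      rewrite area_cons /area (perm_big _ pl) /= big_cat /=.
      rewrite big1_seq ?add0n; last by move=> x /andP[_]; rewrite mem_nseq => /andP[_ /eqP].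
      by rewrite -/(area _) area_mapS sw.
    have -> : dinv (0%N :: l) = (r.-1 + dinv l)%N.
      rewrite dinv_cons (permP pl) count_cat count_nseq /= mul1n.
      by rewrite count_map (@eq_count _ _ pred0) ?count_pred0 ?addn0.
    have -> : count_mem 0%N (0%N :: l) = r.
      rewrite /= (permP pl) count_cat count_nseq /= mul1n.
      by rewrite count_map (@eq_count _ _ pred0) ?count_pred0 ?addn0 ?add1n ?prednK.
    by rewrite !exprD; ring.
  rewrite -mulr_sumr insert_zeros_weight // dinv_mapS count_map /g.
  rewrite (@eq_count _ (preim succn (pred1 1%N)) (pred1 0%N)) //.
  have -> : 'C(r, 2) = (r.-1 + 'C(r.-1, 2))%N.
    by rewrite -{1}(prednK r_gt0) binS bin1 addnC.
  by rewrite !exprD; set G := gbin _ _ _; ring.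
rewrite -mulr_sumr Theta_v0.
have [n_r|n_gtr] := posnP (n - r).
  rewrite n_r big_seq1 Phi0 /area big_nil dinvE big_ord0 /g gbin0; ring.
rewrite IHn //; last lia.
rewrite PhiE // (_ : \sum_(1 <= _ < _) Theta q t 0 (n - r) _ * g _ =
  \sum_(1 <= m < (n - r).+1) gbin q (r + m).-1 m * Theta q t 0 (n - r) m).
  by set S := \sum_(_ <= _ < _) _; ring.
apply: eq_big_nat => m /andP[m_gt0 _]; rewrite mulrC /g; congr (gbin _ _ _ * _); lia.
Qed.

Theorem dyck_seqs_gf n : (0 < n)%N ->
  \sum_(l <- dyck_seqs n) t ^+ area l * q ^+ dinv l = Phi q t 0 n 1.
Proof.
move=> n_gt0; under eq_bigr do rewrite -[_ * _]mulr1.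
rewrite (dyck_seqs_weight (fun=> 1)) // PhiE //; apply: eq_big_nat => m _.
by rewrite add1n /= gbinn mulr1 mul1r.
Qed.

End Weights.

Lemma card_dyck_paths n d a :
  #|dyck_paths n d a| =
  count (fun l => (defc l == d) && ((area l)%:Z == a)) (dyck_seqs n).
Proof.
rewrite -size_filter cardE -(size_map (fun u : n.-tuple 'I_n => map val u)).
apply/perm_size/uniq_perm.
- rewrite map_inj_uniq ?enum_uniq // => u v /= /(inj_map val_inj) uv.
  exact: val_inj.
- by rewrite filter_uniq ?dyck_seqs_uniq.
move=> l; rewrite mem_filter mem_dyck_seqs; apply/mapP/idP => [[u]|].
  by rewrite mem_enum inE => /and3P[du dd da] ->; rewrite dd da du size_map size_tuple eqxx.
case/andP=> /andP[dl al] /andP[kl /eqP sl].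
have lt_l i : (nth 0 l i < n)%N \/ (n <= i)%N.
  have [lti|] := ltnP i n; last by right.
  by left; apply: leq_ltn_trans (dyck_nth_leq kl _) _; rewrite ?sl.
have all_l : all (fun x => x < n)%N l.
  by apply/(all_nthP 0%N) => i; rewrite sl => lti; case: (lt_l i) => //; lia.
have vl : map val (pmap insub l : seq 'I_n) = l.
  rewrite (pmap_filter (insubK _)); apply/all_filterP.
  by apply: sub_all all_l => x ltx; rewrite /= insubT.
have su : size (pmap insub l : seq 'I_n) == n by rewrite -(size_map val) vl sl.
exists (Tuple su); last by rewrite /= vl.
by rewrite mem_enum inE /= vl kl dl al.
Qed.

(** * Evaluation and interpolation at 0 *)

Section Morphism.
Variables (R S : comNzRingType) (f : {rmorphism R -> S}) (q t : R).

Lemma gbin_morph n k : f (gbin q n k) = gbin (f q) n k.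
Proof.
elim: n k => [|n IHn] [|k]; rewrite ?gbin0 ?rmorph1 //.
  by rewrite !gbin_small ?rmorph0.
by rewrite !gbinS rmorphD rmorphM rmorphXn !IHn.
Qed.

Lemma Phi_morph v N r : f (Phi q t v N r) = Phi (f q) (f t) (f v) N r.
Proof.
elim/ltn_ind: N r => -[_ r|N IHN r]; first by rewrite !Phi0 rmorph1.
rewrite !PhiE // rmorph_sum; apply: eq_big_nat => m /andP[m_gt0 ltm].
rewrite rmorphM gbin_morph /Theta rmorphM rmorphXn rmorph_sum.
congr (_ * (_ * _)); apply: eq_bigr => e _.
by rewrite !rmorphM !rmorphXn gbin_morph IHN //; lia.
Qed.

End Morphism.

Lemma size_prod_affine (K : fieldType) (s : seq K) (P : pred K) (c : K -> K) :
  (size (\prod_(y <- s | P y) (c y *: (y%:P - 'X)))%R <= (count P s).+1)%N.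
Proof.
elim: s => [|y s IHs]; first by rewrite big_nil size_poly1.
rewrite big_cons /=; case: ifP => // _; rewrite add1n.
apply: leq_trans (size_polyMleq _ _) _.
have : (size (c y *: (y%:P - 'X))%R <= 2)%N.
  by apply: leq_trans (size_scale_leq _ _) _; rewrite -size_polyN opprB size_XsubC.
move: IHs; set a := size _; set b := size _; lia.
Qed.

Lemma lagrange0 (K : fieldType) (s : seq K) (g : {poly K}) :
  uniq s -> (size g <= size s)%N ->
  g.[0] = \sum_(x <- s) g.[x] * \prod_(y <- s | y != x) (y / (y - x)).
Proof.
move=> us sg.
pose l x := \prod_(y <- s | y != x) ((y - x)^-1 *: (y%:P - 'X)).
pose h := \sum_(x <- s) g.[x] *: l x.
have lE x z : (l x).[z] = \prod_(y <- s | y != x) ((y - z) / (y - x)).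
  rewrite horner_prod; apply: eq_bigr => y _.
  by rewrite hornerZ hornerD hornerN hornerC hornerX mulrC.
have sh : (size h <= size s)%N.
  rewrite /h big_seq; elim/big_ind: _ => [|u v su sv|x xs]; first by rewrite size_poly0.
    by apply: leq_trans (size_polyD _ _) _; rewrite geq_max su.
  apply: leq_trans (size_scale_leq _ _) _.
  apply: leq_trans (size_prod_affine _ _ _) _.
  rewrite -(count_predC (pred1 x) s) count_uniq_mem // xs add1n ltnS.
  by rewrite (@eq_count _ _ (predC (pred1 x))).
have hs x : x \in s -> h.[x] = g.[x].
  move=> xs; rewrite /h horner_sum (bigD1_seq x) //= big1_seq ?addr0.
    rewrite hornerZ lE big1 ?mulr1 // => y neyx.
    by rewrite divff // subr_eq0.
  move=> y /andP[neyx ys]; rewrite hornerZ lE (big_rem x xs) eq_sym neyx.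
  by rewrite /= subrr !mul0r mulr0.
have -> : g = h.
  apply/eqP; rewrite -subr_eq0; apply/eqP; apply: (roots_geq_poly_eq0 (rs := s)) => //.
    by apply/allP => x xs; rewrite rootE hornerD hornerN hs ?subrr.
  apply: leq_trans (size_polyD _ _) _; rewrite size_polyN geq_max sg.
  by rewrite sh.
rewrite {1}/h horner_sum; apply: eq_big_seq => x xs.
by rewrite hornerZ lE hs //; under eq_bigr do rewrite subr0.
Qed.

Lemma Phi_horner (R : comNzRingType) (q t x : R) N r :
  (Phi q%:P t%:P (- 'X) N r).[x] = Phi q t (- x) N r.
Proof.
have EC c : horner_eval x c%:P = c by rewrite horner_evalE hornerC.
have EX : horner_eval x (- 'X) = - x by rewrite horner_evalE hornerN hornerX.
transitivity (Phi (horner_eval x q%:P) (horner_eval x t%:P) (horner_eval x (- 'X)) N r).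
  exact: (Phi_morph (horner_eval x)).
by rewrite EX !EC.
Qed.

(** * Weighted degrees in two variables *)

Local Notation biv := {poly {poly int}}.
Local Notation qv := ('X : biv).
Local Notation tv := ('X%:P : biv).

(** A polynomial in q over the polynomials in t: the coefficient of t^a q^b in p
is p`_b`_a.  The variable t has weight al and q has weight be. *)
Definition wdeg_le (al be : nat) (c : int) (p : biv) :=
  forall a b, p`_b`_a != 0 -> (al * a + be * b)%N%:Z <= c.

Section WeightedDegree.
Variables al be : nat.
Implicit Types (p r : biv) (c d : int).
Notation wdeg_le := (wdeg_le al be).

Lemma wdeg0 c : wdeg_le c 0.
Proof. by move=> a b; rewrite !coef0 eqxx. Qed.

Lemma wdegW c d p : c <= d -> wdeg_le c p -> wdeg_le d p.
Proof. by move=> lecd pc a b /pc /le_trans; apply. Qed.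

Lemma wdegD c p r : wdeg_le c p -> wdeg_le c r -> wdeg_le c (p + r).
Proof.
move=> pc rc a b; rewrite !coefD => pr_neq0.
have [p0|/pc //] := eqVneq (p`_b`_a) 0.
by apply: rc; rewrite p0 add0r in pr_neq0.
Qed.

Lemma wdegN c p : wdeg_le c p -> wdeg_le c (- p).
Proof. by move=> pc a b; rewrite !coefN oppr_eq0; apply: pc. Qed.

Lemma wdegM c d p r : wdeg_le c p -> wdeg_le d r -> wdeg_le (c + d) (p * r).
Proof.
move=> pc rd a b; apply: contraNT => gt_cd.
rewrite coefM coef_sum big1 // => j _; rewrite coefM big1 // => i _.
have [->|/pc le_c] := eqVneq (p`_j`_i) 0; first by rewrite mul0r.
have [->|/rd le_d] := eqVneq (r`_(b - j)`_(a - i)) 0; first by rewrite mulr0.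
case/negP: gt_cd; apply: le_trans (lerD le_c le_d).
rewrite -PoszD lez_nat; have := ltn_ord j; have := ltn_ord i; nia.
Qed.

Lemma wdeg_monomial i j c : (al * i + be * j)%N%:Z <= c -> wdeg_le c (tv ^+ i * qv ^+ j).
Proof.
move=> lec a b; rewrite -polyC_exp mulrC coefXnM coefC.
case: ltnP => [_|leb]; first by rewrite coef0 eqxx.
case: (eqVneq (b - j)%N 0%N) => [ej|_]; last by rewrite coef0 eqxx.
rewrite coefXn; case: (eqVneq a i) => [-> _|_]; last by rewrite eqxx.
by rewrite (_ : b = j) //; lia.
Qed.

Lemma wdeg1 : wdeg_le 0 1.
Proof. by rewrite -[1](mulr1) -{1}(expr0 tv) -(expr0 qv); apply: wdeg_monomial; rewrite !muln0. Qed.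

Lemma wdegX i : wdeg_le (be * i)%N%:Z (qv ^+ i).
Proof. by rewrite -[_ ^+ _]mul1r -(expr0 tv); apply: wdeg_monomial; rewrite muln0. Qed.

Lemma wdegT i : wdeg_le (al * i)%N%:Z (tv ^+ i).
Proof. by rewrite -[_ ^+ _]mulr1 -(expr0 qv); apply: wdeg_monomial; rewrite muln0 addn0. Qed.

Lemma wdeg_sum I (s : seq I) (P : pred I) (F : I -> biv) c :
  (forall i, P i -> wdeg_le c (F i)) -> wdeg_le c (\sum_(i <- s | P i) F i).
Proof.
move=> Fc; elim/big_rec: _ => [|i x Pi xc]; first exact: wdeg0.
by apply: wdegD => //; apply: Fc.
Qed.

Lemma wdeg_sum_nat m n (F : nat -> biv) c :
  (forall i, (m <= i < n)%N -> wdeg_le c (F i)) -> wdeg_le c (\sum_(m <= i < n) F i).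
Proof. by move=> Fc; rewrite big_nat_cond; apply: wdeg_sum => i; rewrite andbT; apply: Fc. Qed.

Lemma wdeg_prod_nat n (F : nat -> biv) (c : nat) :
  (forall i, (i < n)%N -> wdeg_le c%:Z (F i)) ->
  wdeg_le (c * n)%N%:Z (\prod_(0 <= i < n) F i).
Proof.
elim: n => [|n IHn] Fc; first by rewrite big_geq // muln0; apply: wdeg1.
rewrite big_nat_recr //= mulnS addnC PoszD; apply: wdegM; last exact: Fc.
by apply: IHn => i lti; apply: Fc; lia.
Qed.

Lemma wdeg_gbin n k : wdeg_le (be * (k * (n - k)))%N%:Z (gbin qv n k).
Proof.
elim: n k => [|n IHn] [|k].
- by rewrite gbin0 mul0n muln0; apply: wdeg1.
- by rewrite gbin_small //; apply: wdeg0.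
- by rewrite gbin0 mul0n muln0; apply: wdeg1.
have [ltnk|lekn] := ltnP n k; first by rewrite gbin_small //; apply: wdeg0.
rewrite gbinS; apply: wdegD.
  by apply: wdegW (IHn k); rewrite lez_nat; nia.
have [ltnk|lekn'] := ltnP n k.+1; first by rewrite gbin_small // mulr0; apply: wdeg0.
apply: wdegW (wdegM (@wdegX k.+1) (IHn k.+1)).
by rewrite -PoszD lez_nat subSS -mulnDr leq_mul2l; apply/orP; right; nia.
Qed.

(** With g = m + m' - i, the left-hand side is i m - m' + k g - k (3 k - 1) / 2;
the last hypothesis says that k >= g. *)
Lemma psi_term_deg i m m' k : (0 < k)%N -> (k <= m')%N -> (m' <= i)%N ->
  (k <= m)%N -> (m + m' - k <= i)%N ->
  ((m' - k) * (k - 1) + 'C(k, 2) + k * (m - k) + i * (m - k) <=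
   minn (i.+1 * m.-1) (i * m - m'))%N.
Proof.
move=> k_gt0 lekm' lem'i lekm ltg; have := bin2_double k; rewrite leq_min.
move: ('C(k, 2)) => B EB.
have [x Ex] : {x | m = (k + x)%N} by exists (m - k)%N; lia.
have [y Ey] : {y | m' = (k + y)%N} by exists (m' - k)%N; lia.
have [z Ez] : {z | i = (k + x + y + z)%N} by exists (i - (k + x + y))%N; lia.
have [l El] : {l | k = l.+1} by exists k.-1; lia.
rewrite El /= in EB *; subst m m' i k.
rewrite (_ : (l.+1 + y - l.+1 = y)%N); last lia.
rewrite (_ : (l.+1 + x - l.+1 = x)%N); last lia.
rewrite subn1 /=; apply/andP; split; nia.
Qed.

(** A summand of psi does not vanish at - q^i only if the exponents in its product
all stay below i, and then every factor has degree i. *)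
Lemma wdeg_psi i m m' : (0 < m')%N -> (m' <= i)%N ->
  wdeg_le (be * minn (i.+1 * m.-1) (i * m - m'))%N%:Z (psi qv (- qv ^+ i) m m').
Proof.
move=> m'_gt0 lem'i; apply: wdeg_sum_nat => j /andP[_ ltj].
have [jm'|nejm'] := eqVneq j m'.
  by rewrite jm' gbin_small ?mul0r; [apply: wdeg0 | lia].
have [k Ek] : {k | m' = (j + k)%N} by exists (m' - j)%N; lia.
have k_gt0 : (0 < k)%N by lia.
rewrite (_ : (m' - j = k)%N); last lia.
have [ltmk|lekm] := ltnP m k.
  by rewrite (@gbin_small _ _ m) // mulr0 mul0r; apply: wdeg0.
have [lti|lei] := ltnP i (m + m' - k).
  rewrite (_ : \prod_(_ <= _ < _) _ = 0) ?mulr0; first exact: wdeg0.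
  apply/eqP; rewrite prodf_seq_eq0; apply/hasP; exists (i - m')%N.
    by rewrite mem_index_iota; lia.
  by rewrite subnKC //= addrC subrr.
have lek : (k <= m')%N by lia.
apply: wdegW (wdegM (wdegM (wdegM (@wdeg_gbin _ _) (@wdegX _)) (@wdeg_gbin _ _))
  (@wdeg_prod_nat _ _ (be * i) _)); last first.
  move=> l ltl; apply: wdegD; first by apply: wdegN; apply: wdegX.
  by apply: wdegW (@wdegX _); rewrite lez_nat leq_mul2l; apply/orP; right; lia.
rewrite -!PoszD lez_nat -mulnA -!mulnDr leq_mul2l; apply/orP; right.
have := psi_term_deg k_gt0 lek lem'i lekm lei.
apply: leq_trans; rewrite !leq_add2r (_ : j = (m' - k)%N); last lia.
by rewrite leq_mul2l; apply/orP; right; lia.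
Qed.

End WeightedDegree.

(** The exponents in the product range from m' to at least m - 1, so i is one of
them. *)
Lemma psi_eq0 i m m' : (0 < m')%N -> (m' <= i)%N -> (i < m)%N ->
  psi qv (- qv ^+ i) m m' = 0.
Proof.
move=> m'_gt0 lem'i ltim; rewrite /psi big_nat_cond big1 // => j.
rewrite andbT => /andP[_ ltj].
have [jm'|nejm'] := eqVneq j m'; first by rewrite jm' gbin_small ?mul0r //; lia.
rewrite (_ : \prod_(_ <= _ < _) _ = 0) ?mulr0 //.
apply/eqP; rewrite prodf_seq_eq0; apply/hasP; exists (i - m')%N.
  by rewrite mem_index_iota; lia.
by rewrite subnKC //= addrC subrr.
Qed.

(** This starts from the top level, which contributes a product of differences
q^l - q^i; the levels below are treated by psi_eq0. *)
Lemma Theta_eq0 i N m : (i < m)%N -> (m <= N)%N ->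
  Theta qv tv (- qv ^+ i) N m = 0.
Proof.
elim/ltn_ind: N m => N IHN m ltim; rewrite leq_eqVlt => /orP[/eqP<-|ltmN].
  rewrite Theta_diag; apply/eqP; rewrite prodf_seq_eq0; apply/hasP; exists i.
    by rewrite mem_index_iota.
  by rewrite /= addrC subrr.
rewrite Theta_rec // big_nat_cond big1 ?mulr0 // => m'.
rewrite andbT => /andP[m'_gt0 ltm'].
have [lem'i|lt_im'] := leqP m' i; first by rewrite psi_eq0 ?mul0r.
by rewrite IHN ?mulr0 //; lia.
Qed.

(** * Degrees of the values at - q ^ i *)

(** The linear part comes from the bound (i + 1) (m - 1) of wdeg_psi at each level
and from the powers of t.  The cases of the correction are: no level above the given one, at
most i entries above, hence possibly just one level, and at least two
levels. *)
Definition Rbound (i N m : nat) : int :=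
  ((2 * i + 1) * N)%N%:Z - (2 * i + 2)%N%:Z +
  (if N == m then (2 * i + 2)%N%:Z - N%:Z
   else if (N <= m + i)%N then Num.min m%:Z (m%:Z + i%:Z + 1 - N%:Z)
   else 'C((N - (2 * i + 2)).+1, 2)%:Z).

Lemma wdeg_Theta_step al be i N m (c : int) (B : nat -> int) :
  (m < N)%N ->
  (forall m', (0 < m')%N -> (m' <= i)%N -> (m' <= N - m)%N ->
     wdeg_le al be (B m') (Theta qv tv (- qv ^+ i) (N - m) m') /\
     (al * (N - m) + be * minn (i.+1 * m.-1) (i * m - m'))%N%:Z + B m' <= c) ->
  wdeg_le al be c (Theta qv tv (- qv ^+ i) N m).
Proof.
move=> ltmN HB; rewrite Theta_rec //.
rewrite mulr_sumr; apply: wdeg_sum_nat => m' /andP[m'_gt0 ltm'].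
have [lem'i|lt_im'] := leqP m' i; last first.
  by rewrite Theta_eq0 // !mulr0; apply: wdeg0.
have [Bm' le_c] := HB m' m'_gt0 lem'i ltm'.
apply: wdegW (wdegM (@wdegT al be _) (wdegM (@wdeg_psi al be i m m' m'_gt0 lem'i) Bm')).
by rewrite addrA -PoszD.
Qed.

Lemma wdeg_Theta_diag al be i m : (m <= i)%N ->
  wdeg_le al be (be * i * m)%N%:Z (Theta qv tv (- qv ^+ i) m m).
Proof.
move=> lemi; rewrite Theta_diag; apply: wdeg_prod_nat => l ltl.
apply: wdegD; first by apply: wdegN; apply: wdegX.
by apply: wdegW (@wdegX _ _ _); rewrite lez_nat leq_mul2l; apply/orP; right; lia.
Qed.

Lemma bin2S n : 'C(n.+1, 2) = ('C(n, 2) + n)%N.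
Proof. by rewrite binS bin1. Qed.

Lemma leq_bin2 m n : (m <= n)%N -> ('C(m, 2) <= 'C(n, 2))%N.
Proof. by move=> le_mn; have := bin2_double m; have := bin2_double n; case: m le_mn => [|m]; case: n => [|n] //=; nia. Qed.

(** Which of the two bounds of wdeg_psi is the better one depends on the sign of
m + m' - i - 1; the induction uses both. *)
Lemma Rbound_step i N m m' : (0 < m)%N -> (m <= i)%N -> (0 < m')%N -> (m' <= i)%N ->
  (m' <= N - m)%N ->
  (1 * (N - m) + 2 * minn (i.+1 * m.-1) (i * m - m'))%N%:Z + Rbound i (N - m) m' <=
  Rbound i N m.
Proof.
move=> m_gt0 lemi m'_gt0 lem'i lem'.
have [N' EN] : {N' | N = (m + N')%N} by exists (N - m)%N; lia.
have -> : (N - m = N')%N by lia.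
have lem'N : (m' <= N')%N by lia.
pose z := (i.+1 * m.-1)%N; pose y := (i * m - m')%N.
have Ez : z%:Z = (i * m)%N%:Z + m%:Z - i%:Z - 1 by rewrite /z; case: m m_gt0 {lemi lem' EN y z} => // m _ /=; lia.
have Ey : y%:Z = (i * m)%N%:Z - m'%:Z by rewrite /y subzn //; nia.
rewrite -/z -/y /Rbound EN.
have -> : (m + N' == m)%N = false by lia.
have E1 : ((2 * i + 1) * (m + N') = 2 * (i * m) + m + (2 * i + 1) * N')%N by lia.
rewrite E1; move: ((2 * i + 1) * N')%N (i * m)%N Ez Ey => X Y Ez Ey.
clearbody z y.
have [le1|gt1] := leqP (m + N') (m + i).
  case: eqP => [Em'|nem']; first by lia.
  have -> : (N' <= m' + i)%N by lia.
  lia.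
have -> : (N' == m') = false by lia.
case: leqP => [le2|gt2]; first by lia.
have := bin2S (m + N' - (2 * i + 2)).
have [le3|gt3] := leqP (m + N') (2 * i + 2).
  rewrite (_ : (N' - (2 * i + 2) = 0)%N); last lia.
  rewrite (_ : 'C(1, 2) = 0%N) //; lia.
have : ('C((N' - (2 * i + 2)).+1, 2) <= 'C(m + N' - (2 * i + 2), 2))%N.
  by apply: leq_bin2; lia.
lia.
Qed.

Lemma wdeg_Theta_R i N m : (0 < m)%N -> (m <= i)%N -> (m <= N)%N ->
  wdeg_le 1 2 (Rbound i N m) (Theta qv tv (- qv ^+ i) N m).
Proof.
elim/ltn_ind: N m => N IHN m m_gt0 lemi; rewrite leq_eqVlt => /orP[/eqP<-|ltmN].
  apply: wdegW (@wdeg_Theta_diag 1 2 i m lemi).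
  by rewrite /Rbound eqxx; lia.
apply: (wdeg_Theta_step (B := Rbound i (N - m))) => // m' m'_gt0 lem'i lem'.
by split; [apply: IHN => //; lia | apply: Rbound_step].
Qed.

(** Apart from the correction in Rbound, twice the difference of the two sides is
(2 i + 2 - N) (2 i + 1 - N), a product of consecutive integers. *)
Lemma Rbound_le i N m : (0 < m)%N -> (m <= i)%N -> (m <= N)%N ->
  Rbound i N m <= ('C(N, 2) + 2 * i ^ 2 + i)%N%:Z - 1.
Proof.
move=> m_gt0 lemi lemN.
have E := bin2_double N.
have E2 : (('C(N, 2) * 2)%N%:Z = N%:Z * N%:Z - N%:Z) by rewrite E; case: (N) => [|k] //=; lia.
rewrite /Rbound; case: eqP => [ENm|nENm].
  subst m; nia.
case: leqP => [le1|gt1].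
  have H : 2 * Num.min m%:Z (m%:Z + i%:Z + 1 - N%:Z) <=
      (2 * i%:Z + 2 - N%:Z) * (2 * i%:Z + 1 - N%:Z).
    have [y Ey] : {y | (2 * i + 2 = N + y.+2)%N} by exists (2 * i - N)%N; lia.
    have -> : 2 * i%:Z + 2 - N%:Z = y%:Z + 2 by lia.
    have -> : 2 * i%:Z + 1 - N%:Z = y%:Z + 1 by lia.
    have [le2|gt2] := leqP N i.+1; last by nia.
    have : (m <= y.+1)%N by lia.
    nia.
  nia.
have E3 := bin2_double (N - (2 * i + 2)).+1.
have [le3|gt3] := leqP N (2 * i + 2).
  rewrite (_ : (N - (2 * i + 2) = 0)%N) in E3 *; last lia.
  rewrite (_ : 'C(1, 2) = 0%N) //.
  have H : 0 <= (2 * i%:Z + 2 - N%:Z) * (2 * i%:Z + 1 - N%:Z).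
    have [y Ey] : {y | (2 * i + 2 = N + y)%N} by exists (2 * i + 2 - N)%N; lia.
    have -> : 2 * i%:Z + 2 - N%:Z = y%:Z by lia.
    have -> : 2 * i%:Z + 1 - N%:Z = y%:Z - 1 by lia.
    by case: y {Ey} => [|y]; nia.
  nia.
have [w Ew] : {w | N = (w + 2 * i + 2)%N} by exists (N - (2 * i + 2))%N; lia.
rewrite (_ : (N - (2 * i + 2) = w)%N) in E3 *; last lia.
rewrite /= in E3; nia.
Qed.

(** The (2, 1)-degree favours area, so the worst case has one entry in almost
every level, which gives N^2 - N.  The quotient by 4 is the maximum of
(j + 1) x - x^2, for a top level of x entries; a single level is the worst case
as long as 2 N <= j + 2. *)
Lemma wdeg_Theta_L j N m : (0 < m)%N -> (m <= j)%N -> (m <= N)%N ->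
  wdeg_le 2 1 ((N * N - N + (j.+1 ^ 2) %/ 4)%N%:Z) (Theta qv tv (- qv ^+ j) N m) /\
  ((2 * N <= j + 2)%N -> wdeg_le 2 1 (j * N)%N%:Z (Theta qv tv (- qv ^+ j) N m)).
Proof.
have kap1 : (j.+1 ^ 2 < ((j.+1 ^ 2) %/ 4).+1 * 4)%N by rewrite ltn_ceil.
have kap2 x : (j * x <= x * x - x + (j.+1 ^ 2) %/ 4)%N.
  move: kap1; move: (_ %/ _)%N => k; case: x => [|x]; first by rewrite muln0.
  rewrite (_ : (x.+1 * x.+1 - x.+1 = x * x.+1)%N); last nia.
  by have := sqr_ge0 (j.+1%:Z - 2 * x.+1%:Z); rewrite expr2; nia.
move: ((j.+1 ^ 2) %/ 4)%N kap1 kap2 => k kap1 kap2.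
elim/ltn_ind: N m => N IHN m m_gt0 lemj; rewrite leq_eqVlt => /orP[/eqP<-|ltmN].
  have H := @wdeg_Theta_diag 2 1 j m lemj; rewrite mul1n in H.
  by split=> [|_ //]; apply: wdegW H; rewrite lez_nat.
have [x Ex] : {x | N = (m + x)%N} by exists (N - m)%N; lia.
have Ex' : (N - m = x)%N by lia.
split=> [|le2N].
  have [le2x|gt2x] := leqP (j + 1 + m) (2 * N).
    apply: (wdeg_Theta_step (B := fun=> (x * x - x + k)%N%:Z)) => // m' m'_gt0 lem'i.
    rewrite Ex' => lem'; split; first by case: (IHN x _ m' m'_gt0 lem'i lem') => //; lia.
    rewrite -PoszD lez_nat; apply: leq_trans (_ : 2 * x + j.+1 * m.-1 + (x * x - x + k) <= _)%N.
      by rewrite leq_add2r leq_add2l mul1n geq_minl.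
    rewrite Ex; case: m m_gt0 Ex {lemj ltmN Ex'} le2x => // m _ Ex le2x /=.
    case: x Ex lem' => [|x] Ex lem'; first by lia.
    rewrite (_ : (x.+1 * x.+1 - x.+1 = x * x.+1)%N); last nia.
    rewrite (_ : ((m.+1 + x.+1) * (m.+1 + x.+1) - (m.+1 + x.+1) = (m.+1 + x) * (m.+1 + x.+1))%N); last nia.
    nia.
  apply: (wdeg_Theta_step (B := fun=> (j * x)%N%:Z)) => // m' m'_gt0 lem'i.
  rewrite Ex' => lem'; split; first by case: (IHN x _ m' m'_gt0 lem'i lem') => [|_]; [lia | apply; lia].
  rewrite -PoszD lez_nat; apply: leq_trans (kap2 N).
  apply: leq_trans (_ : 2 * x + j.+1 * m.-1 + j * x <= _)%N.
    by rewrite leq_add2r leq_add2l mul1n geq_minl.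
  by rewrite Ex; case: m m_gt0 Ex gt2x {lemj ltmN Ex'} => // m _ Ex gt2x /=; nia.
apply: (wdeg_Theta_step (B := fun=> (j * x)%N%:Z)) => // m' m'_gt0 lem'i.
rewrite Ex' => lem'; split; first by case: (IHN x _ m' m'_gt0 lem'i lem') => [|_]; [lia | apply; lia].
rewrite -PoszD lez_nat.
apply: leq_trans (_ : 2 * x + j.+1 * m.-1 + j * x <= _)%N.
  by rewrite leq_add2r leq_add2l mul1n geq_minl.
by rewrite Ex; case: m m_gt0 Ex {lemj ltmN Ex'} => // m _ Ex /=; nia.
Qed.

(** * Large or small bottom level *)

(** Here J = j + 1, and x is the number of entries above a level of m entries. *)
Lemma L_bound_arith J m x r k : (0 < m)%N -> (m < J)%N -> (0 < x)%N ->
  (1 < r)%N -> (2 * x < 2 * m + r)%N -> (4 * k <= J ^ 2)%N ->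
  (2 * x + J * m.-1 + (x * x - x + k) + 2 * (m + x) + m * r.-1 <=
   'C(m + x, 2) + (m + x) * r + J ^ 2 - 1)%N.
Proof.
move=> m_gt0 ltmJ x_gt0 r_gt1 ltx lek.
have [d Ed] : {d | J = (m + 1 + d)%N} by exists (J - m - 1)%N; lia.
(* Four times the claim, once J has been replaced by its lower bound m + 1. *)
have : (2 * (x * x) + 14 * x <= m * m + 4 * (m * x) + 4 * (x * r) + 3)%N.
  have [lexm|ltmx] := leqP x m.
    have [u Eu] : {u | m = (x + u)%N} by exists (m - x)%N; lia.
    have [s Es] : {s | x = s.+1} by exists x.-1; lia.
    have [y Ey] : {y | r = y.+2} by exists r.-2; lia.
    by subst m x r; nia.
  have [u Eu] : {u | x = (m + u.+1)%N} by exists (x - m).-1; lia.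
  have [a Ea] : {a | m = a.+1} by exists m.-1; lia.
  have [y Ey] : {y | r = (2 * u + 3 + y)%N} by exists (r - (2 * u + 3))%N; lia.
  by subst m x r; nia.
have := bin2_double (m + x); rewrite !expnS expn0 muln1 in lek *.
have [x' Ex] : {x' | x = x'.+1} by exists x.-1; lia.
have [m' Em] : {m' | m = m'.+1} by exists m.-1; lia.
subst x m J; rewrite addSn /=.
rewrite (_ : (x'.+1 * x'.+1 - x'.+1 = x' * x'.+1)%N); last nia.
have [y Ey] : {y | r = y.+1} by exists r.-1; lia.
subst r; rewrite /=; nia.
Qed.

(** With n = N + r, the bottom level of r entries costs (r - 1) (N - m) pairs that
count neither for area nor for dinv.  If r > 1 and 2 N < 4 m + r, this makes
the (2, 1)-degree small.  Otherwise adding the bottom level raises the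
(1, 2)-degree by at most the difference of the binomials of n and N. *)
Lemma piece_bound j r m N : (0 < r)%N -> (0 < m)%N -> (m <= j)%N -> (m <= N)%N ->
  let p := qv ^+ 'C(r, 2) * tv ^+ N * (gbin qv (r + m).-1 m * Theta qv tv (- qv ^+ j) N m) in
  wdeg_le 1 2 (('C(N + r, 2) + 2 * j ^ 2 + j)%N%:Z - 1) p \/
  wdeg_le 2 1 ('C(N + r, 2) + j ^ 2 + 2 * j)%N%:Z p.
Proof.
move=> r_gt0 m_gt0 lemj lemN p.
have base al be c :
    wdeg_le al be (c - (be * 'C(r, 2) + al * N + be * (m * r.-1))%N%:Z) (Theta qv tv (- qv ^+ j) N m) ->
    wdeg_le al be c p.
  move=> H; apply: wdegW (wdegM (wdegM (@wdegX al be _) (@wdegT al be _))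
    (wdegM (@wdeg_gbin al be _ _) H)).
  by rewrite (_ : ((r + m).-1 - m = r.-1)%N); lia.
have Er := bin2_double r.
have EN : 'C(N + r, 2) = ('C(N, 2) + 'C(r, 2) + N * r)%N by apply: bin2D.
have [r1|r_gt1] := leqP r 1.
  left; apply: base; apply: wdegW (wdeg_Theta_R m_gt0 lemj lemN).
  apply: le_trans (Rbound_le m_gt0 lemj lemN) _.
  rewrite EN (_ : r = 1%N); last lia.
  by rewrite (_ : 'C(1, 2) = 0%N) //=; lia.
have [leN|ltN] := leqP (4 * m + r) (2 * N).
  left; apply: base; apply: wdegW (wdeg_Theta_R m_gt0 lemj lemN).
  apply: le_trans (Rbound_le m_gt0 lemj lemN) _.
  rewrite EN; clear p EN; case: r r_gt0 r_gt1 Er leN => // r _ _ /= Er leN; nia.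
right; apply: base.
move: lemN; rewrite leq_eqVlt => /orP[/eqP EmN|ltmN].
  have H := @wdeg_Theta_diag 2 1 j m lemj.
  rewrite -EmN; apply: wdegW H; rewrite EmN EN -EmN.
  clear p EN; case: r r_gt0 r_gt1 Er ltN => // r _ _ /= Er ltN; nia.
have [x Ex] : {x | N = (m + x)%N} by exists (N - m)%N; lia.
apply: (wdeg_Theta_step (B := fun=> (x * x - x + (j.+1 ^ 2) %/ 4)%N%:Z)) => // m' m'_gt0 lem'j.
rewrite (_ : (N - m = x)%N); last lia.
move=> lem'; split; first by case: (wdeg_Theta_L m'_gt0 lem'j lem').
have lek : (4 * (j.+1 ^ 2 %/ 4) <= j.+1 ^ 2)%N by rewrite mulnC leq_trunc_div.
have x_gt0 : (0 < x)%N by lia.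
have ltx : (2 * x < 2 * m + r)%N by lia.
have := L_bound_arith m_gt0 (lemj : (m < j.+1)%N) x_gt0 r_gt1 ltx lek.
rewrite EN Ex bin2D.
move: (geq_minl (j.+1 * m.-1) (j * m - m')).
have -> : (j.+1 ^ 2 = j ^ 2 + 2 * j + 1)%N by lia.
by lia.
Qed.

Definition wsplit (c d : int) (p : biv) :=
  exists pL pR, [/\ p = pL + pR, wdeg_le 2 1 c pL & wdeg_le 1 2 d pR].

Lemma wsplit_sum_nat m n (F : nat -> biv) c d :
  (forall i, (m <= i < n)%N -> wsplit c d (F i)) ->
  wsplit c d (\sum_(m <= i < n) F i).
Proof.
move=> Fc; rewrite big_seq; elim/big_rec: _ => [|i x].
  by exists 0, 0; split; rewrite ?addr0 //; apply: wdeg0.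
rewrite mem_index_iota => /Fc[pL [pR [-> HL HR]]] [xL [xR [-> HxL HxR]]].
exists (pL + xL), (pR + xR); split; [by ring | exact: wdegD | exact: wdegD].
Qed.

Lemma Phi_wsplit j n :
  wsplit ('C(n, 2) + j ^ 2 + 2 * j)%N%:Z (('C(n, 2) + 2 * j ^ 2 + j)%N%:Z - 1)
    (\sum_(1 <= r < n.+1) qv ^+ 'C(r, 2) * tv ^+ (n - r) *
       Phi qv tv (- qv ^+ j) (n - r) r).
Proof.
apply: wsplit_sum_nat => r /andP[r_gt0 ltr].
have [nr0|nr_gt0] := posnP (n - r).
  exists (qv ^+ 'C(r, 2) * tv ^+ (n - r) * Phi qv tv (- qv ^+ j) (n - r) r), 0.
  split; rewrite ?addr0 //; last exact: wdeg0.
  rewrite nr0 Phi0 !mulr1 (_ : r = n); last lia.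
  by apply: wdegW (@wdegX 2 1 _); rewrite lez_nat; lia.
rewrite PhiE // mulr_sumr; apply: wsplit_sum_nat => m /andP[m_gt0 ltm].
set p := _ * _.
have [lemj|ltjm] := leqP m j; last first.
  exists 0, 0; split; rewrite ?addr0; [|exact: wdeg0|exact: wdeg0].
  by rewrite /p Theta_eq0 ?mulr0 //; lia.
have := @piece_bound j r m (n - r) r_gt0 m_gt0 lemj ltm.
rewrite subnK // -/p => -[H|H].
  by exists 0, p; split; rewrite ?add0r //; apply: wdeg0.
by exists p, 0; split; rewrite ?addr0 //; apply: wdeg0.
Qed.

(** * Weighted degrees of fractions *)

Local Notation frac := {fraction biv}.
Local Notation "x %:F" := (tofrac x : frac) : ring_scope.

Lemma coefM2 (p r : biv) a b : (p * r)`_b`_a =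
  \sum_(j < b.+1) \sum_(i < a.+1) p`_j`_i * r`_(b - j)`_(a - i).
Proof. by rewrite coefM coef_sum; apply: eq_bigr => j _; rewrite coefM. Qed.

Lemma coefM2_single (p r : biv) a b a' b' :
  (forall i j i' j', (i + i' = a + a')%N -> (j + j' = b + b')%N ->
     p`_j`_i != 0 -> r`_j'`_i' != 0 -> i = a /\ j = b) ->
  (p * r)`_(b + b')`_(a + a') = p`_b`_a * r`_b'`_a'.
Proof.
move=> single; rewrite coefM2.
have lta : (a < (a + a').+1)%N by lia.
have ltb : (b < (b + b').+1)%N by lia.
rewrite (bigD1 (Ordinal ltb)) //= (bigD1 (Ordinal lta)) //=.
rewrite -[RHS]addr0 -addrA !addKn; congr (_ + _).
have zero (j : 'I_(b + b').+1) (i : 'I_(a + a').+1) :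
    ~ (i = a :> nat /\ j = b :> nat) -> p`_j`_i * r`_(b + b' - j)`_(a + a' - i) = 0.
  move=> neq; apply/eqP; rewrite mulf_eq0; apply/norP => -[pn rn].
  by apply: neq; apply: (single _ _ _ _ _ _ pn rn); rewrite subnKC // -ltnS.
rewrite big1 => [|i neia]; last first.
  have := zero (Ordinal ltb) i; rewrite /= addKn; apply.
  by move=> -[Ei _]; case/eqP: neia; apply: val_inj.
rewrite big1 ?addr0 // => j nejb; rewrite big1 // => i _.
by apply: zero => -[_ Ej]; case/eqP: nejb; apply: val_inj.
Qed.

(** The monomial t^a q^b of D is the largest one for the (2, 1)-degree, for the
(1, 2)-degree and for the lexicographic order with q before t.  Such monomials
multiply, so both degrees are additive on the denominators that have one. *)
Definition lead (D : biv) a b := D`_b`_a != 0 /\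
  forall a' b', D`_b'`_a' != 0 ->
    [&& 2 * a' + b' <= 2 * a + b, a' + 2 * b' <= a + 2 * b
      & (b' < b) || (b' == b) && (a' <= a)]%N.

Lemma lead_neq0 D a b : lead D a b -> D != 0.
Proof. by case=> Dn _; apply: contraNneq Dn => ->; rewrite !coef0. Qed.

Lemma lead_mul D D' a b a' b' :
  lead D a b -> lead D' a' b' -> lead (D * D') (a + a') (b + b').
Proof.
move=> [Dn HD] [Dn' HD']; split.
  rewrite coefM2_single ?mulf_neq0 // => i j i' j' Ei Ej /HD/and3P[_ _ H] /HD'/and3P[_ _ H'].
  by lia.
move=> x y; apply: contraNT => nle; rewrite coefM2 big1 // => j _; rewrite big1 // => i _.
have [->|/HD H] := eqVneq (D`_j`_i) 0; first by rewrite mul0r.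
have [->|/HD' H'] := eqVneq (D'`_(y - j)`_(x - i)) 0; first by rewrite mulr0.
by case/negP: nle; have := ltn_ord i; have := ltn_ord j; lia.
Qed.

Definition grading (al be : nat) := ((al, be) == (2, 1)%N) || ((al, be) == (1, 2)%N).

Lemma lead_wdeg_le al be D a b : grading al be -> lead D a b ->
  wdeg_le al be (al * a + be * b)%N%:Z D.
Proof.
by move=> /orP[]/eqP[-> ->] [_ HD] x y /HD/and3P[H1 H2 _]; rewrite lez_nat; lia.
Qed.

Section Cones.
Variables al be : nat.
Hypothesis albe : grading al be.

Definition fdeg_le (c : int) (X : frac) := exists N D a b,
  [/\ lead D a b, X * D%:F = N%:F & wdeg_le al be (c + (al * a + be * b)%N%:Z) N].

Lemma lead1 : lead 1 0 0.
Proof.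
split; first by rewrite !coef1.
move=> a b; rewrite coef1; case: b => [|b]; rewrite ?coef0 ?eqxx //=.
by rewrite coef1; case: a => [|a].
Qed.

Lemma fdeg_poly c p : wdeg_le al be c p -> fdeg_le c p%:F.
Proof.
move=> pc; exists p, 1, 0%N, 0%N; split; first exact: lead1.
  by rewrite tofrac1 mulr1.
by rewrite !muln0 addr0.
Qed.

Lemma fdegW c d X : c <= d -> fdeg_le c X -> fdeg_le d X.
Proof.
move=> lecd [N [D [a [b [HD E HN]]]]]; exists N, D, a, b; split=> //.
by apply: wdegW HN; rewrite lerD2r.
Qed.

Lemma fdegD c X Y : fdeg_le c X -> fdeg_le c Y -> fdeg_le c (X + Y).
Proof.
move=> [N [D [a [b [HD E HN]]]]] [N' [D' [a' [b' [HD' E' HN']]]]].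
exists (N * D' + N' * D), (D * D'), (a + a')%N, (b + b')%N; split.
- exact: lead_mul.
- by rewrite tofracD !tofracM -E -E'; ring.
apply: wdegD.
  by apply: wdegW (wdegM HN (lead_wdeg_le albe HD')); lia.
by apply: wdegW (wdegM HN' (lead_wdeg_le albe HD)); lia.
Qed.

Lemma fdegM c d X Y : fdeg_le c X -> fdeg_le d Y -> fdeg_le (c + d) (X * Y).
Proof.
move=> [N [D [a [b [HD E HN]]]]] [N' [D' [a' [b' [HD' E' HN']]]]].
exists (N * N'), (D * D'), (a + a')%N, (b + b')%N; split.
- exact: lead_mul.
- by rewrite !tofracM -E -E'; ring.
by apply: wdegW (wdegM HN HN'); lia.
Qed.

Lemma fdeg1 : fdeg_le 0 1.
Proof. by rewrite -tofrac1; apply: fdeg_poly; apply: wdeg1. Qed.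

Lemma fdeg_prod_nat m n (F : nat -> frac) (c : nat -> int) :
  (forall i, (m <= i < n)%N -> fdeg_le (c i) (F i)) ->
  fdeg_le (\sum_(m <= i < n) c i) (\prod_(m <= i < n) F i).
Proof.
move=> Fc; rewrite [X in fdeg_le X _]big_seq [X in fdeg_le _ X]big_seq.
elim/big_rec2: _ => [|i x y]; first exact: fdeg1.
by rewrite mem_index_iota => /Fc Fi xy; apply: fdegM.
Qed.

Lemma fdeg_frac c N D a b : lead D a b ->
  wdeg_le al be (c + (al * a + be * b)%N%:Z) N -> fdeg_le c (N%:F / D%:F).
Proof.
move=> HD HN; exists N, D, a, b; split=> //.
by rewrite divfK // tofrac_eq0 (lead_neq0 HD).
Qed.

End Cones.

Definition fsplit (c : int) (X : frac) := exists XL XR,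
  [/\ X = XL + XR, fdeg_le 2 1 c XL & fdeg_le 1 2 c XR].

Lemma fdeg0 al be c : fdeg_le al be c 0.
Proof. by rewrite -tofrac0; apply: fdeg_poly; apply: wdeg0. Qed.

Lemma fsplitL c X : fdeg_le 2 1 c X -> fsplit c X.
Proof. by move=> H; exists X, 0; split; rewrite ?addr0 //; apply: fdeg0. Qed.

Lemma fsplitR c X : fdeg_le 1 2 c X -> fsplit c X.
Proof. by move=> H; exists 0, X; split; rewrite ?add0r //; apply: fdeg0. Qed.

Lemma fsplit_sum I (s : seq I) (P : pred I) (F : I -> frac) c :
  (forall i, P i -> fsplit c (F i)) -> fsplit c (\sum_(i <- s | P i) F i).
Proof.
move=> HF; elim/big_rec: _ => [|i X Pi [XL [XR [-> HL HR]]]].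
  by apply: fsplitL; apply: fdeg0.
have [YL [YR [-> HL' HR']]] := HF i Pi.
exists (YL + XL), (YR + XR); split; first by ring.
  exact: fdegD.
exact: fdegD.
Qed.

(** Multiply by the product D of the two denominators.  If a monomial of p
violated both bounds, then the lexicographically largest one, times the leading
monomial of D, would survive in p D, where all monomials satisfy the bound of
one of the two numerators. *)
Theorem fsplit_poly c (p : biv) : fsplit c p%:F ->
  forall a b, p`_b`_a != 0 ->
    ((2 * a + b)%N%:Z <= c) || ((a + 2 * b)%N%:Z <= c).
Proof.
move=> [XL [XR [EX [NL [DL [aL [bL [leadL EL HL]]]]] [NR [DR [aR [bR [leadR ER HR]]]]]]]].
have E : p * (DL * DR) = NL * DR + NR * DL.
  apply/eqP; rewrite -tofrac_eq; apply/eqP; rewrite tofracD !tofracM EX -EL -ER; ring.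
have [Dn HD] := lead_mul leadL leadR.
have [a0 Ea0] : {x | (aL + aR)%N = x} by exists (aL + aR)%N.
have [b0 Eb0] : {x | (bL + bR)%N = x} by exists (bL + bR)%N.
rewrite Ea0 Eb0 in Dn HD; move: (DL * DR) E Dn HD => D E Dn HD.
pose good a b := ((2 * a + b)%N%:Z <= c) || ((a + 2 * b)%N%:Z <= c).
have step a b : (forall a' b', (b < b')%N || (b' == b) && (a < a')%N ->
    p`_b'`_a' != 0 -> good a' b') -> p`_b`_a != 0 -> good a b.
  move=> IH pn; have [//|bad] := boolP (good a b).
  have : (p * D)`_(b + b0)`_(a + a0) != 0.
    rewrite coefM2_single ?mulf_neq0 // => i j i' j' Ei Ej pij /HD H'.
    have [H|nH] := boolP ((b < j)%N || (j == b) && (a < i)%N).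
      by have := IH i j H pij; rewrite /good in bad *; lia.
    by lia.
  move=> nz; case/eqP: (nz); rewrite E !coefD.
  have -> : (NL * DR)`_(b + b0)`_(a + a0) = 0.
    apply/eqP; apply: contraT => /(wdegM HL (@lead_wdeg_le 2 1 DR aR bR isT leadR)).
    by rewrite /good in bad; lia.
  rewrite add0r; apply/eqP; apply: contraT => /(wdegM HR (@lead_wdeg_le 1 2 DL aL bL isT leadL)).
  by rewrite /good in bad; lia.
suff H (k l a b : nat) : (size p <= b + k)%N -> (size (p`_b)%R <= a + l)%N -> p`_b`_a != 0 -> good a b.
  by move=> a b; apply: (H (size p) (size p`_b)); apply: leq_addl.
elim: k l a b => [|k IHk].
  by move=> l a b; rewrite addn0 => leb _; rewrite (nth_default 0 leb) coef0 eqxx.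
elim=> [|l IHl] a b leb.
  by rewrite addn0 => lea; rewrite (nth_default 0 lea) eqxx.
move=> lea.
apply: step => a' b' /orP[ltb|/andP[/eqP-> lta]].
  by apply: (IHk (size p`_b')); [lia | apply: leq_addl].
by apply: IHl; lia.
Qed.

(** * Interpolation and the theorem *)

Definition mon a b : biv := tv ^+ a * qv ^+ b.

Lemma coef_mon a b x y : (mon a b)`_y`_x = ((x == a) && (y == b))%:R.
Proof.
rewrite /mon -polyC_exp coefCM coefXn.
by case: (y == b); rewrite ?mulr1 ?mulr0 ?coef0 ?andbF // coefXn andbT.
Qed.

(** The condition for the difference of two monomials to have a leading monomial
in the sense of lead. *)
Definition dominates a b a' b' :=
  [&& 2 * a' + b' <= 2 * a + b, a' + 2 * b' <= a + 2 * b
    & (b' < b) || (b' == b) && (a' < a)]%N.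

Lemma lead_binomial a b a' b' : dominates a b a' b' ->
  lead (mon a b - mon a' b') a b.
Proof.
case/and3P=> le1 le2 lt3; split.
  rewrite !coefD !coefN !coef_mon !eqxx /= (_ : (a == a') && (b == b') = false) ?subr0 //.
  by lia.
move=> x y; rewrite !coefD !coefN !coef_mon.
have [/andP[/eqP-> /eqP->] _|_] := boolP ((x == a) && (y == b)); first by lia.
have [/andP[/eqP-> /eqP->] _|_] := boolP ((x == a') && (y == b')); first by lia.
by rewrite subr0 eqxx.
Qed.

Lemma wdeg_mon al be a b c : (al * a + be * b)%N%:Z <= c -> wdeg_le al be c (mon a b).
Proof. exact: wdeg_monomial. Qed.

Lemma fdeg_dominant al be a b a' b' : dominates a b a' b' ->
  fdeg_le al be 0 ((mon a b)%:F / ((mon a b)%:F - (mon a' b')%:F)).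
Proof.
move=> /lead_binomial HD; rewrite -tofracB; apply: fdeg_frac HD _.
by apply: wdeg_mon; rewrite add0r.
Qed.

Lemma lead_opp D a b : lead D a b -> lead (- D) a b.
Proof.
case=> Dn HD; split; first by rewrite !coefN oppr_eq0.
by move=> x y; rewrite !coefN oppr_eq0; apply: HD.
Qed.

Lemma fdeg_dominated al be a b a' b' (c : int) : dominates a b a' b' ->
  (al * a' + be * b')%N%:Z - (al * a + be * b)%N%:Z <= c ->
  fdeg_le al be c ((mon a' b')%:F / ((mon a' b')%:F - (mon a b)%:F)).
Proof.
move=> /lead_binomial/lead_opp; rewrite opprB => HD lec; rewrite -tofracB.
by apply: fdeg_frac HD _; apply: wdeg_mon; lia.
Qed.

Lemma mon_frac_eq a b a' b' :
  ((mon a b)%:F == (mon a' b')%:F) = (a == a') && (b == b').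
Proof.
rewrite tofrac_eq; apply/eqP/andP => [E|[/eqP-> /eqP->] //].
have := congr1 (fun p : biv => p`_b`_a) E.
by rewrite !coef_mon !eqxx /=; case: (a == a'); case: (b == b').
Qed.

Lemma prod_skip (F : nat -> frac) p k : (k < p)%N ->
  \prod_(0 <= j < p | j != k) F j = \prod_(0 <= j < k) F j * \prod_(k.+1 <= j < p) F j.
Proof.
move=> ltkp; rewrite (@big_cat_nat _ _ _ k) //=; last exact: ltnW.
rewrite [X in _ * X]big_ltn_cond // eqxx /=; congr (_ * _).
  rewrite big_nat_cond [RHS]big_nat_cond; apply: eq_bigl => j.
  by rewrite andbT; case: (ltnP j k) => //= ltj; rewrite neq_ltn ltj.
rewrite big_nat_cond [RHS]big_nat_cond; apply: eq_bigl => j.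
by rewrite andbT; case: (ltnP k j) => //= ltj; rewrite neq_ltn ltj orbT ?andbT.
Qed.

Lemma prod_isolate (F : nat -> frac) p k : (k < p)%N ->
  \prod_(0 <= j < p) F j = F k * (\prod_(0 <= j < k) F j * \prod_(k.+1 <= j < p) F j).
Proof.
move=> ltkp; rewrite (@big_cat_nat _ _ _ k) //=; last exact: ltnW.
by rewrite [X in _ * X]big_ltn // mulrCA.
Qed.

Lemma sum_arith (al be : int) k :
  (\sum_(0 <= l < k) (al * l%:Z + be)) * 2 = al * (k%:Z * k%:Z - k%:Z) + 2 * be * k%:Z.
Proof.
elim: k => [|k IHk]; first by rewrite big_geq //; lia.
by rewrite big_nat_recr //= mulrDl IHk; lia.
Qed.

Lemma factor_out (K : comNzRingType) (u w g e x f : K) : u * x = w ->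
  u * (g * (e * (x * f))) = w * (g * (e * f)).
Proof. by move=> <-; ring. Qed.

Lemma factor_out_l (K : comNzRingType) (u w g x e f : K) : u * x = w ->
  u * (g * (x * e * f)) = g * (w * (e * f)).
Proof. by move=> <-; ring. Qed.

Lemma cancel_pair_l (K : fieldType) (Q T : K) k : Q != 0 -> Q - T != 0 ->
  (Q - T) * (Q ^+ k.+1 / (Q ^+ k.+1 - T * Q ^+ k)) = Q.
Proof.
move=> Qn QTn; have Qk : Q ^+ k != 0 by rewrite expf_neq0.
rewrite exprS -mulrBl; field.
by rewrite Qk QTn.
Qed.

Lemma cancel_pair_r (K : fieldType) (Q T : K) k : Q != 0 -> Q - T != 0 ->
  (Q - T) * (T * Q ^+ k / (T * Q ^+ k - Q ^+ k.+1)) = - T.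
Proof.
move=> Qn QTn; have Qk : Q ^+ k != 0 by rewrite expf_neq0.
have TQn : T - Q != 0 by rewrite -opprB oppr_eq0.
rewrite exprS -mulrBl; field.
by rewrite Qk TQn.
Qed.

(** The degree of the Lagrange coefficient at t q^j, except for the pair of nodes
that cancel_q takes care of. *)
Lemma t_exponent (al be : nat) (j : nat) :
  \sum_(0 <= l < j.+1) (be%:Z * l%:Z + (- (al%:Z + be%:Z * j%:Z))) +
  \sum_(0 <= l < j) (be%:Z * l%:Z + - (be%:Z * j%:Z)) =
  - (be%:Z * (j%:Z * (j%:Z + 1)) + al%:Z * (j%:Z + 1)).
Proof.
have := sum_arith be%:Z (- (al%:Z + be%:Z * j%:Z)) j.+1.
have := sum_arith be%:Z (- (be%:Z * j%:Z)) j.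
set U := \sum_(_ <= _ < _) _; set V := \sum_(_ <= _ < _) _ => EU EV.
suff : (V + U) * 2 = - (be%:Z * (j%:Z * (j%:Z + 1)) + al%:Z * (j%:Z + 1)) * 2 by lia.
rewrite mulrDl EU EV; lia.
Qed.

Section Interpolation.
Variable n : nat.
Hypothesis n_gt0 : (0 < n)%N.

Let Q : frac := qv%:F.
Let T : frac := tv%:F.
(* In terms of x = - v the nodes are monomials. *)
Let G : {poly frac} := Phi Q%:P T%:P (- 'X) n 1.
Let P x := Phi qv tv x n 1.
Let nodes p := [seq (mon 0 i)%:F | i <- index_iota 0 p.+1] ++
           [seq (mon 1 j)%:F | j <- index_iota 0 p].

Lemma G_eval (x : biv) : G.[x%:F] = (P (- x))%:F.
Proof.
by rewrite /P /G Phi_horner Phi_morph rmorphN.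
Qed.

Lemma nodes_uniq p : uniq (nodes p).
Proof.
rewrite cat_uniq !map_inj_in_uniq ?iota_uniq ?andbT /nodes //.
- by apply/hasPn => x /mapP[j _ ->]; apply/negP => /mapP[i _ /eqP]; rewrite mon_frac_eq.
- by move=> i j _ _ /eqP; rewrite mon_frac_eq => /andP[_ /eqP].
- by move=> i j _ _ /eqP; rewrite mon_frac_eq => /andP[_ /eqP].
Qed.

Lemma mon_frac a b : (mon a b)%:F = T ^+ a * Q ^+ b.
Proof. by rewrite /mon rmorphM !rmorphXn. Qed.

Lemma Q_neq0 : Q != 0.
Proof. by rewrite tofrac_eq0 polyX_eq0. Qed.

Lemma QT_neq0 : Q - T != 0.
Proof.
rewrite subr_eq0 tofrac_eq; apply/eqP => /(congr1 (fun p : biv => p`_1)).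
by rewrite coefX coefC /= => /eqP; rewrite oner_eq0.
Qed.

(** The nodes q^(k+1) and t q^k are the only ones that dominates does not
compare. *)
Lemma cancel_q k : (Q - T) * ((mon 0 k.+1)%:F / ((mon 0 k.+1)%:F - (mon 1 k)%:F)) = Q.
Proof. by rewrite !mon_frac expr0 mul1r expr1 (cancel_pair_l k Q_neq0 QT_neq0). Qed.

Lemma cancel_t k : (Q - T) * ((mon 1 k)%:F / ((mon 1 k)%:F - (mon 0 k.+1)%:F)) = - T.
Proof. by rewrite !mon_frac expr0 mul1r expr1 (cancel_pair_r k Q_neq0 QT_neq0). Qed.

Lemma prod_nodes_q p i (F : frac -> frac) :
  \prod_(y <- nodes p | y != (mon 0 i)%:F) F y =
  (\prod_(0 <= k < p.+1 | k != i) F (mon 0 k)%:F) *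
  \prod_(0 <= k < p) F (mon 1 k)%:F.
Proof.
rewrite /nodes big_cat !big_map; congr (_ * _); apply: eq_bigl => k.
  by rewrite mon_frac_eq.
by rewrite mon_frac_eq.
Qed.

Lemma prod_nodes_t p j (F : frac -> frac) :
  \prod_(y <- nodes p | y != (mon 1 j)%:F) F y =
  (\prod_(0 <= k < p.+1) F (mon 0 k)%:F) *
  \prod_(0 <= k < p | k != j) F (mon 1 k)%:F.
Proof.
rewrite /nodes big_cat !big_map; congr (_ * _); apply: eq_bigl => k.
  by rewrite mon_frac_eq.
by rewrite mon_frac_eq.
Qed.

(** The Lagrange coefficient, multiplied by q - t, has (1, 2)-degree
- 2 i^2 - i + 2. *)
Lemma fdeg_q_term p i : (0 < i)%N -> (i <= p)%N ->
  fdeg_le 1 2 ('C(n, 2)%:Z + 1) ((Q - T) *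
    (G.[(mon 0 i)%:F] * \prod_(y <- nodes p | y != (mon 0 i)%:F) (y / (y - (mon 0 i)%:F)))).
Proof.
move=> i_gt0 lei; rewrite prod_nodes_q prod_skip; last lia.
rewrite (@prod_isolate _ p i.-1); last lia.
set A := \prod_(0 <= j < i) _; set B := \prod_(_ <= _ < p.+1) _.
set X := _ / _; set C := \prod_(_ <= _ < i.-1) _; set D := \prod_(_ <= _ < p) _.
have EX : (Q - T) * X = - T by have := cancel_t i.-1; rewrite (prednK i_gt0).
have -> : (Q - T) * (G.[(mon 0 i)%:F] * (A * B * (X * (C * D)))) =
  - T * (G.[(mon 0 i)%:F] * (A * B * (C * D))) by apply: factor_out.
have lr : grading 1 2 by [].
have HT : fdeg_le 1 2 1 (- T).
  rewrite -rmorphN; apply: fdeg_poly; apply: wdegN.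
  by have := @wdegT 1 2 1; rewrite muln1.
have HG : fdeg_le 1 2 (('C(n, 2) + 2 * i ^ 2 + i)%N%:Z - 1) G.[(mon 0 i)%:F].
  rewrite G_eval; apply: fdeg_poly; rewrite /P /mon mul1r PhiE //.
  apply: wdeg_sum_nat => m /andP[m_gt0 ltm]; rewrite add1n gbinn mul1r.
  have [lemi|ltim] := leqP m i; last by rewrite Theta_eq0 //; apply: wdeg0.
  by apply: wdegW (wdeg_Theta_R m_gt0 lemi ltm); apply: Rbound_le.
have HA := fdeg_prod_nat (al := 1) (be := 2) lr (m := 0) (n := i)
   (c := fun l => 2 * l%:Z + - (2 * i%:Z))
   (F := fun l => (mon 0 l)%:F / ((mon 0 l)%:F - (mon 0 i)%:F)).
have HB := fdeg_prod_nat (al := 1) (be := 2) lr (m := i.+1) (n := p.+1)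
   (c := fun=> 0) (F := fun l => (mon 0 l)%:F / ((mon 0 l)%:F - (mon 0 i)%:F)).
have HC := fdeg_prod_nat (al := 1) (be := 2) lr (m := 0) (n := i.-1)
   (c := fun l => 2 * l%:Z + (1 - 2 * i%:Z))
   (F := fun l => (mon 1 l)%:F / ((mon 1 l)%:F - (mon 0 i)%:F)).
have HD := fdeg_prod_nat (al := 1) (be := 2) lr (m := i.-1.+1) (n := p)
   (c := fun=> 0) (F := fun l => (mon 1 l)%:F / ((mon 1 l)%:F - (mon 0 i)%:F)).
have {}HA := HA _; have {}HB := HB _; have {}HC := HC _; have {}HD := HD _.
apply: fdegW (fdegM lr HT (fdegM lr HG (fdegM lr (fdegM lr (HA _) (HB _)) (fdegM lr (HC _) (HD _))))).
- rewrite !big1_eq; have := sum_arith 2 (- (2 * i%:Z)) i.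
  have := sum_arith 2 (1 - 2 * i%:Z) i.-1.
  rewrite (_ : i.-1%:Z = i%:Z - 1); last lia.
  set U := \sum_(_ <= _ < _) _; set V := \sum_(_ <= _ < _) _ => EV EU; nia.
- by move=> l ltl; apply: fdeg_dominated; rewrite ?/dominates; lia.
- by move=> l ltl; apply: fdeg_dominant; rewrite ?/dominates; lia.
- by move=> l ltl; apply: fdeg_dominated; rewrite ?/dominates; lia.
- by move=> l ltl; apply: fdeg_dominant; rewrite ?/dominates; lia.
Qed.

Lemma fdeg_t_prefactor p j al be : grading al be -> (j < p)%N ->
  let y k := (mon 0 k)%:F / ((mon 0 k)%:F - (mon 1 j)%:F) in
  let z k := (mon 1 k)%:F / ((mon 1 k)%:F - (mon 1 j)%:F) in
  fdeg_le al be (be%:Z - (be%:Z * (j%:Z * (j%:Z + 1)) + al%:Z * (j%:Z + 1)))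
   (Q * (\prod_(0 <= k < j.+1) y k * \prod_(j.+2 <= k < p.+1) y k *
    (\prod_(0 <= k < j) z k * \prod_(j.+1 <= k < p) z k))).
Proof.
move=> lr ltjp y z.
have HQ : fdeg_le al be be%:Z Q.
  by apply: fdeg_poly; have := @wdegX al be 1; rewrite muln1.
have HA := fdeg_prod_nat lr (m := 0) (n := j.+1) (F := y)
   (c := fun l => be%:Z * l%:Z + (- (al%:Z + be%:Z * j%:Z))).
have HB := fdeg_prod_nat lr (m := j.+2) (n := p.+1) (F := y) (c := fun=> 0).
have HC := fdeg_prod_nat lr (m := 0) (n := j) (F := z)
   (c := fun l => be%:Z * l%:Z + - (be%:Z * j%:Z)).
have HD := fdeg_prod_nat lr (m := j.+1) (n := p) (F := z) (c := fun=> 0).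
apply: fdegW (fdegM lr HQ (fdegM lr (fdegM lr (HA _) (HB _)) (fdegM lr (HC _) (HD _)))).
- rewrite !big1_eq !addr0 t_exponent; lia.
- by move=> l ltl; apply: fdeg_dominated; rewrite ?/dominates //; lia.
- by move=> l ltl; apply: fdeg_dominant; rewrite ?/dominates //; lia.
- by move=> l ltl; apply: fdeg_dominated; rewrite ?/dominates //; lia.
- by move=> l ltl; apply: fdeg_dominant; rewrite ?/dominates //; lia.
Qed.

(** The Lagrange coefficient, multiplied by q - t, has (2, 1)-degree
- j^2 - 3 j - 1 and (1, 2)-degree - 2 j^2 - 3 j + 1; the factor 1 - t q^j of
Phi1_shift adds j + 2 and 2 j + 1. *)
Lemma fsplit_t_term p j : (j < p)%N ->
  fsplit ('C(n, 2)%:Z + 1) ((Q - T) *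
    (G.[(mon 1 j)%:F] * \prod_(y <- nodes p | y != (mon 1 j)%:F) (y / (y - (mon 1 j)%:F)))).
Proof.
move=> ltjp; rewrite prod_nodes_t prod_skip // (@prod_isolate _ p.+1 j.+1) //.
rewrite (factor_out_l _ _ _ (cancel_q j)).
set E := _ * _ * _; set Pj := G.[_].
have HE al be : grading al be -> fdeg_le al be
    (be%:Z - (be%:Z * (j%:Z * (j%:Z + 1)) + al%:Z * (j%:Z + 1))) (Q * E).
  by move=> lr; apply: fdeg_t_prefactor.
move: (Q * E) HE => W HW.
have EP : - mon 1 j = tv * (- qv ^+ j) by rewrite /mon expr1 mulrN.
have [pL [pR [Ep HL HR]]] := Phi_wsplit j n.
rewrite /Pj G_eval /P EP Phi1_shift // Ep mulrDr tofracD mulrDl.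
have H1 al be : wdeg_le al be (al + be * j)%N%:Z (1 + tv * - qv ^+ j).
  apply: wdegD; first by apply: wdegW (@wdeg1 al be).
  rewrite mulrN; apply: wdegN; have := @wdeg_mon al be 1 j (al + be * j)%N.
  by rewrite /mon expr1 muln1; apply.
exists (((1 + tv * - qv ^+ j) * pL)%:F * W), (((1 + tv * - qv ^+ j) * pR)%:F * W); split=> //.
  apply: fdegW (fdegM (isT : grading 2 1) (fdeg_poly (wdegM (H1 2%N 1%N) HL)) (HW 2%N 1%N isT)); lia.
apply: fdegW (fdegM (isT : grading 1 2) (fdeg_poly (wdegM (H1 1%N 2%N) HR)) (HW 1%N 2%N isT)); lia.
Qed.

Theorem fsplit_dyck : fsplit ('C(n, 2)%:Z + 1) ((qv - tv) * Phi qv tv 0 n 1)%:F.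
Proof.
(* The 2 p + 1 nodes must outnumber the degree of G. *)
pose p := (size G).+1.
have szs : (size G <= size (nodes p))%N.
  by rewrite size_cat !size_map !size_iota /p; lia.
have := lagrange0 (nodes_uniq p) szs.
have -> : G.[0] = (Phi qv tv 0 n 1)%:F by rewrite -tofrac0 G_eval /P oppr0.
move=> E; rewrite tofracM E tofracB -/Q -/T mulr_sumr {1}/nodes big_cat !big_map.
have cl (X Y : frac) : fsplit ('C(n, 2)%:Z + 1) X -> fsplit ('C(n, 2)%:Z + 1) Y ->
    fsplit ('C(n, 2)%:Z + 1) (X + Y).
  move=> HX HY; have := @fsplit_sum bool [:: true; false] xpredT
     (fun b => if b then X else Y) ('C(n, 2)%:Z + 1).
  by rewrite !big_cons big_nil addr0; apply; case.
apply: cl.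
  (* The node 1 contributes nothing, as P_n(- 1) = 0. *)
  rewrite big_seq; apply: fsplit_sum => i; rewrite mem_index_iota => /andP[_ lti].
  apply: fsplitR; case: i lti => [|i] lti; last exact: fdeg_q_term.
  rewrite G_eval /P (_ : Phi _ _ _ _ _ = 0) ?tofrac0 ?mul0r ?mulr0; first exact: fdeg0.
  rewrite /mon mul1r expr0 PhiE // big_nat_cond big1 // => m.
  rewrite andbT => /andP[m_gt0 ltm].
  by have := @Theta_eq0 0 n m m_gt0 ltm; rewrite expr0 => ->; rewrite mulr0.
rewrite big_seq; apply: fsplit_sum => j; rewrite mem_index_iota => /andP[_ ltj].
exact: fsplit_t_term.
Qed.

End Interpolation.

Lemma Phi_coef n a b : (0 < n)%N ->
  (Phi qv tv 0 n 1)`_b`_a =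
  (count (fun l => (area l == a) && (dinv l == b)) (dyck_seqs n))%:Z.
Proof.
move=> n_gt0; rewrite -dyck_seqs_gf // coef_sum coef_sum -sum1_count.
rewrite (big_morph Posz PoszD (erefl _)) [RHS]big_mkcond; apply: eq_bigr => l _.
have := coef_mon (area l) (dinv l) a b; rewrite /mon => ->.
by rewrite (eq_sym a) (eq_sym b); case: (_ && _).
Qed.

Lemma card_dyck_paths_coef n (d a : nat) : (0 < n)%N -> (d + a <= 'C(n, 2))%N ->
  #|dyck_paths n d a|%:Z = (Phi qv tv 0 n 1)`_('C(n, 2) - d - a)`_a.
Proof.
move=> n_gt0 le_da; rewrite Phi_coef // card_dyck_paths; congr Posz.
apply: eq_in_count => l; rewrite mem_dyck_seqs => /andP[_ /eqP sl].
by rewrite /defc sl andbC eqz_nat; case: eqP => //= ->; lia.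
Qed.

(** The two numbers are the coefficients in C_n whose difference is the
coefficient of t^(a + 1) q^(b + 1) in (q - t) C_n. *)
Lemma card_dyck_paths_succ n (d a : nat) : (0 < n)%N ->
  (d <= a)%N -> (a.+1 + 2 * d <= 'C(n, 2))%N ->
  #|dyck_paths n d a.+1| = #|dyck_paths n d a|.
Proof.
move=> n_gt0 leda lea; apply/eqP; rewrite -eqz_nat; apply/eqP.
rewrite !card_dyck_paths_coef //; try lia.
have [b Eb] : {b | ('C(n, 2) - d - a = b.+1)%N} by exists ('C(n, 2) - d - a.+1)%N; lia.
rewrite Eb (_ : ('C(n, 2) - d - a.+1 = b)%N); last lia.
apply/eqP; rewrite -subr_eq0; apply: contraT => nz.
have := @fsplit_poly _ _ (fsplit_dyck n_gt0) a.+1 b.+1.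
rewrite mulrBl !coefD !coefN coefXM coefCM coefXM /= => /(_ nz); lia.
Qed.

Lemma card_dyck_paths_base n (d k : nat) : (0 < n)%N ->
  (d + k + 2 * d <= 'C(n, 2))%N ->
  #|dyck_paths n d (d + k)%N| = #|dyck_paths n d d|.
Proof.
move=> n_gt0; elim: k => [|k IHk] lek; first by rewrite addn0.
by rewrite addnS card_dyck_paths_succ ?IHk //; lia.
Qed.

Theorem theorem3p12 (n : nat) (hn : (1 <= n)%N) (d : int) (hd : (0 <= d)%R)
  (a b : int) :
  (d <= a <= 'C(n, 2)%:Z - d *+ 2)%R ->
  (d <= b <= 'C(n, 2)%:Z - d *+ 2)%R ->
  #|dyck_paths n d a| = #|dyck_paths n d b|.
Proof.
case: d hd => // d _.
suff H (c : int) : d%:Z <= c <= 'C(n, 2)%:Z - d%:Z *+ 2 ->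
    #|dyck_paths n d c| = #|dyck_paths n d d|.
  by move=> /H-> /H->.
case: c => [c|c]; last by lia.
rewrite mulr2n => /andP[lec gec].
have [k Ek] : {k | c = (d + k)%N} by exists (c - d)%N; lia.
by rewrite Ek card_dyck_paths_base //; lia.
Qed.
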